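(* $\mathrm{MINCC}$ and $\mathrm{MINRC}$ are solvable in polynomial time on instances in which the graph $G=\bigcup\mathcal{P}$ is a tree and $|X|^{\Delta(G)}$ is bounded by a polynomial in the input size.
   Context: Let $G$ be a finite undirected graph with maximum degree $\Delta(G)$, and let $X=\{1,\dots,|X|\}$ be a set of colors with $|X|\ge \Delta(G)+1$. A proper edge coloring is a map $\chi:E(G)\to X$ assigning distinct colors to edges sharing an endpoint. A traversal cost function is a map $tc:X^2\to\mathbb{R}_{\ge 0}$ with $tc(i,j)=tc(j,i)$ and $tc(i,i)=0$ for all $i,j\in X$. For a path $P=(e_1,\dots,e_\ell)$ (as a sequence of edges), its traversals are the pairs $(e_i,e_{i+1})$, $1\le i<\ell$; the cost of a traversal $t=(e_i,e_{i+1})$ under $\chi$ is $tc_\chi(t)=tc(\chi(e_i),\chi(e_{i+1}))$, and $tc_\chi(P)=\sum_{t} tc_\chi(t)$ over the traversals of $P$. For a set $\mathcal{P}$ of paths, the reload cost is $rc_\chi(\mathcal{P})=\sum_{P\in\mathcal{P}} tc_\chi(P)$, and the changeover cost is $co_\chi(\mathcal{P})=\sum_{t\in \theta(\mathcal{P})} tc_\chi(t)$, where $\theta(\mathcal{P})$ is the set (without multiplicity) of all traversals of paths in $\mathcal{P}$. Problem $\mathrm{MINRC}$ (resp. $\mathrm{MINCC}$): given a set $\mathcal{P}$ of paths, each of length at least $2$, whose union is the graph $G$, a color set $X$ with $|X|\ge\Delta(G)+1$, and a traversal cost function $tc$, find a proper edge coloring $\chi:E(G)\to X$ minimizing $rc_\chi(\mathcal{P})$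 (resp. $co_\chi(\mathcal{P})$). *)

(* Defs.v *)
From mathcomp Require Import all_boot all_order all_algebra.
From mathcomp Require Import reals.

Set Implicit Arguments.
Unset Strict Implicit.
Unset Printing Implicit Defensive.

Import Order.TTheory GRing.Theory Num.Theory.
Local Open Scope ring_scope.

(** * Problem instances *)

(* Vertices are the elements of 'I_(nvert I) and colors those of 'I_(ncol I),
   i.e. the colors 1, ..., |X| shifted to 0, ..., |X| - 1.  A path is given by
   the sequence of vertices it visits; its sequence of edges is [path_edges]. *)
Record instance (K : Type) := Instance {
  nvert : nat;
  ncol  : nat;
  paths : seq (seq 'I_nvert);
  tc    : 'I_ncol -> 'I_ncol -> K
}.

Definition path_edges n (P : seq 'I_n) : seq {set 'I_n} :=
  [seq [set uv.1; uv.2] | uv <- zip P (behead P)].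

Definition traversals n (P : seq 'I_n) : seq ({set 'I_n} * {set 'I_n}) :=
  zip (path_edges P) (behead (path_edges P)).

Section Instance.
Variables (K : realDomainType) (I : instance K).

Definition vertex := 'I_(nvert I).
Definition color := 'I_(ncol I).

Definition edges : {set {set vertex}} :=
  [set e in flatten [seq path_edges P | P <- paths I]].

Definition adj : rel vertex := fun u v => [set u; v] \in edges.

Definition max_degree : nat := (\max_(v : vertex) #|[set w | adj v w]|)%N.

Definition is_tree : Prop :=
  [/\ (0 < nvert I)%N,
      forall u v : vertex, connect adj u v
    & forall c : seq vertex, (2 < size c)%N -> ~ ucycle adj c].

(* A path with at least two edges visits at least three vertices.  The last
   vertex condition says that the vertex set is the union of the paths; for
   edges this holds by definition of [edges]. *)
Definition valid_instance : Prop :=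
  [/\ uniq (paths I),
      forall P, P \in paths I -> uniq P /\ (2 < size P)%N,
      forall v : vertex, exists2 P, P \in paths I & v \in P,
      (max_degree + 1 <= ncol I)%N
    & [/\ forall i j : color, 0 <= tc i j,
          forall i j : color, tc i j = tc j i
        & forall i : color, tc i i = 0]].

(* A coloring is a total function on sets of vertices, of which only the
   values on [edges] matter. *)
Definition coloring := {set vertex} -> color.

Definition proper_coloring (chi : coloring) : Prop :=
  {in edges &, forall e f, e != f -> e :&: f != set0 -> chi e != chi f}.

Definition traversal_cost (chi : coloring) (t : {set vertex} * {set vertex}) :=
  tc (chi t.1) (chi t.2).

Definition reload_cost (chi : coloring) : K :=
  \sum_(P <- paths I) \sum_(t <- traversals P) traversal_cost chi t.

Definition all_traversals : {set {set vertex} * {set vertex}} :=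
  [set t in flatten [seq traversals P | P <- paths I]].

Definition changeover_cost (chi : coloring) : K :=
  \sum_(t in all_traversals) traversal_cost chi t.

Definition minimizes (cost : coloring -> K) (chi : coloring) : Prop :=
  proper_coloring chi /\ forall chi', proper_coloring chi' -> cost chi <= cost chi'.

End Instance.

(** * Model of computation *)

(* A program is a finite list of (possibly mutually recursive) unary functions
   of a strict first-order Lisp working on binary trees, the first one being
   the entry point.  Leaves may hold numbers from K, which programs can only
   add and compare.  Every evaluation step costs 1; an addition or comparison
   moreover costs the size of its operands, as measured by [sz].
   - For K = rat and [sz] the number of bits, this is the logarithmic cost
     measure; as [ECons] shares its arguments and trees cannot be tested for
     equality in one step, it is polynomially related to Turing machine time.
   - For K a field of reals and [sz] constantly 1, this is the arithmetic
     (real-RAM) model, restricted to additions and comparisons. *)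

Inductive data (K : Type) := DNil | DNum of K | DCons of data K & data K.
Arguments DNil {K}.

Inductive expr :=
  | EVar of nat
  | ENil
  | EZero
  | ECons of expr & expr
  | EHd of expr
  | ETl of expr
  | EAdd of expr & expr
  | ELe of expr & expr
  | EIf of expr & expr & expr
  | ELet of expr & expr
  | ECall of nat & expr.

Definition program := seq expr.

Section Semantics.
Variables (K : realDomainType) (sz : K -> nat).
Implicit Types (d v w : data K) (env : seq (data K)).

Definition hd d := if d is DCons a _ then a else DNil.
Definition tl d := if d is DCons _ b then b else DNil.
Definition is_node d := if d is DCons _ _ then true else false.
Definition of_bool (b : bool) : data K := if b then DCons DNil DNil else DNil.
Definition add_num v w :=
  match v, w with DNum x, DNum y => DNum (x + y) | _, _ => DNil end.
Definition le_num v w :=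
  match v, w with DNum x, DNum y => of_bool (x <= y) | _, _ => DNil end.
Definition num_size d := if d is DNum x then sz x else 0%N.

(* [eval p env e v t]: in environment [env] (de Bruijn indices), [e] evaluates
   to [v] in time [t].  The body of a function is evaluated in the environment
   consisting of its argument only. *)
Inductive eval (p : program) : seq (data K) -> expr -> data K -> nat -> Prop :=
  | EvVar env i : eval p env (EVar i) (nth DNil env i) 1%N
  | EvNil env : eval p env ENil DNil 1%N
  | EvZero env : eval p env EZero (DNum 0) 1%N
  | EvCons env a b v w s t :
      eval p env a v s -> eval p env b w t ->
      eval p env (ECons a b) (DCons v w) (s + t + 1)%N
  | EvHd env a v s : eval p env a v s -> eval p env (EHd a) (hd v) (s + 1)%N
  | EvTl env a v s : eval p env a v s -> eval p env (ETl a) (tl v) (s + 1)%N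
  | EvAdd env a b v w s t :
      eval p env a v s -> eval p env b w t ->
      eval p env (EAdd a b) (add_num v w) (s + t + num_size v + num_size w + 1)%N
  | EvLe env a b v w s t :
      eval p env a v s -> eval p env b w t ->
      eval p env (ELe a b) (le_num v w) (s + t + num_size v + num_size w + 1)%N
  | EvIf env c a b v w s t :
      eval p env c v s -> eval p env (if is_node v then a else b) w t ->
      eval p env (EIf c a b) w (s + t + 1)%N
  | EvLet env a b v w s t :
      eval p env a v s -> eval p (v :: env) b w t ->
      eval p env (ELet a b) w (s + t + 1)%N
  | EvCall env f a v w s t :
      eval p env a v s -> eval p [:: v] (nth ENil p f) w t ->
      eval p env (ECall f a) w (s + t + 1)%N.

Definition runs (p : program) (input output : data K) (time : nat) : Prop :=
  eval p [:: input] (nth ENil p 0) output time.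

Fixpoint data_size d : nat :=
  match d with
  | DNil => 1%N
  | DNum x => (sz x).+1
  | DCons a b => (data_size a + data_size b).+1%N
  end.

End Semantics.

Definition bits (m : nat) : nat := (trunc_log 2 m).+1.
Definition rat_bits (x : rat) : nat :=
  (bits `|numq x|%N + bits `|denq x|%N + 1)%N.
Definition unit_size (K : Type) (x : K) : nat := 1%N.

(** * Encodings *)

Section Encoding.
Variable K : realDomainType.

(* Vertices and colors are written in unary.  In a valid instance every vertex
   lies on a path and the cost table has |X|^2 entries, so that this changes
   the size of the input only polynomially. *)
Fixpoint enc_nat (n : nat) : data K :=
  if n is m.+1 then DCons DNil (enc_nat m) else DNil.

Definition enc_seq (T : Type) (enc : T -> data K) (s : seq T) : data K :=
  foldr (fun x d => DCons (enc x) d) DNil s.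

Definition enc_instance (I : instance K) : data K :=
  DCons (enc_nat (nvert I))
 (DCons (enc_nat (ncol I))
 (DCons (enc_seq (enc_seq (fun v : vertex I => enc_nat v)) (paths I))
       (enc_seq (fun i => enc_seq (fun j => DNum (tc i j)) (enum (color I)))
                (enum (color I))))).

Definition enc_coloring (I : instance K)
    (s : seq (vertex I * vertex I * color I)) : data K :=
  enc_seq (fun x : vertex I * vertex I * color I =>
    DCons (DCons (enc_nat x.1.1) (enc_nat x.1.2)) (enc_nat x.2)) s.

(* [s] lists every edge uv, at least once and in any orientation, as (u, v, c)
   where c is the color of uv. *)
Definition lists_coloring (I : instance K)
    (s : seq (vertex I * vertex I * color I)) (chi : coloring I) : Prop :=
  (forall u v c, (u, v, c) \in s ->
     [set u; v] \in edges I /\ chi [set u; v] = c) /\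
  (forall e, e \in edges I ->
     exists u v c, (u, v, c) \in s /\ e = [set u; v]).

End Encoding.

(** * Polynomial-time solvability *)

Section Solvable.
Variables (K : realDomainType) (sz : K -> nat).

Definition input_size (I : instance K) : nat := data_size sz (enc_instance I).

(* A single program and a single polynomial time bound serve all valid
   instances of the class [Q]; nothing is required on other inputs. *)
Definition solvable_in_poly_time
    (cost : forall I : instance K, coloring I -> K)
    (Q : instance K -> Prop) : Prop :=
  exists (p : program) (q : {poly nat}),
  forall I : instance K, valid_instance I -> Q I ->
  exists (s : seq (vertex I * vertex I * color I)) (chi : coloring I) (t : nat),
  [/\ runs sz p (enc_instance I) (enc_coloring s) t,
      (t <= q.[input_size I])%N,
      lists_coloring s chi
    & minimizes (@cost I) chi].

Definition MINRC_poly_time := solvable_in_poly_time (@reload_cost K).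
Definition MINCC_poly_time := solvable_in_poly_time (@changeover_cost K).

Definition tree_with_few_colorings (b : {poly nat}) (I : instance K) : Prop :=
  is_tree I /\ (ncol I ^ max_degree I <= b.[input_size I])%N.

End Solvable.

(* Main.v *)
(* Root the tree G at vertex 0.  For a vertex v and a color c of the edge from v to
   its parent, let V(v, c) be the least cost of the traversals centered in the
   subtree of v.  It obeys V(v, c) = min_a (local cost of a at v + sum_w V(w, a(w))),
   where w runs over the children of v and a over the proper colorings of the edges
   to them; there are at most |X|^Delta of these.  Summing these inequalities over
   all vertices for an arbitrary proper coloring, the values V cancel except at the
   root, which bounds its cost from below, with equality for the coloring built from
   minimizers a from the root downwards.

   The program is obtained by closure: functions computable in time polynomial in
   the input size, uniformly over the instances, are closed under composition and
   under recursion along lists of polynomial length.  Only additions and comparisons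
   depend on the size of numbers, and the size of V(v, c) grows at most additively
   from the children of v to v, hence remains polynomial. *)
Require Import Defs.
From mathcomp Require Import all_boot all_order all_algebra.
From mathcomp Require Import reals.
From mathcomp Require Import zify ring.

Set Implicit Arguments.
Unset Strict Implicit.
Unset Printing Implicit Defensive.

Import Order.TTheory GRing.Theory Num.Theory.

(** * Uniform polynomial-time computability *)

(** One obstacle is uniformity: a single program and a single polynomial must serve all instances.
    Computability is therefore a relation between two families of data over a context, and loop
    variables extend the context without changing its size parameter. The other obstacle is the
    growth of numbers: [rat_bits] is not subadditive, so sizes are controlled through an auxiliary
    measure [g] with g(x + y) <= g(x) + g(y), equivalent to the true size up to a factor 2. For
    rationals it comes from the larger of numerator and denominator; under unit cost it is
    constantly 1. One argument in [sz] and [g] thus covers both models of computation, and a flag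
    [cc] covers both costs, which differ only in whether repeated traversals are dropped. The
    assumption |X| >= Delta + 1 guarantees that every vertex, the root included, can color the edges
    to its children once one color is reserved for the edge above it. Hence no table entry is
    infinite and numbers need no extra value. *)

Class encodable (K : Type) (T : Type) := enc : T -> data K.
Arguments enc {K T _} _.

Record ctx := Ctx { car : Type; ok : car -> Prop; siz : car -> nat }.

(** The size parameter is inherited: the new component, a loop variable or an accumulator, may be
    large without affecting it. Bounds in the extended context are therefore uniform in that
    component. *)
Definition ext (G : ctx) (T : Type) (P : car G -> T -> Prop) : ctx :=
  @Ctx (car G * T) (fun y => ok y.1 /\ P y.1 y.2) (fun y => siz y.1).

(** The base [(siz x).+1] is at least 1, so raising the exponent only weakens the bound; closure
    under sums relies on this. *)
Definition poly_bounded (G : ctx) (h : car G -> nat) : Prop :=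
  exists c d, forall x, ok x -> h x <= c * (siz x).+1 ^ d.

Section PolyBounded.
Variable G : ctx.
Implicit Types h : car G -> nat.

Lemma pb_le h1 h2 : poly_bounded h2 ->
  (forall x, ok x -> h1 x <= h2 x) -> poly_bounded h1.
Proof.
move=> [c [d H]] le; exists c, d => x x_ok.
exact: leq_trans (le x x_ok) (H x x_ok).
Qed.

Lemma pb_const m : poly_bounded (fun _ : car G => m).
Proof. by exists m, 0 => x _; rewrite expn0 muln1. Qed.

Lemma pb_siz : poly_bounded (@siz G).
Proof. by exists 1, 1 => x _; rewrite mul1n expn1. Qed.

Lemma pb_add h1 h2 : poly_bounded h1 -> poly_bounded h2 ->
  poly_bounded (fun x => h1 x + h2 x).
Proof.
move=> [c1 [d1 H1]] [c2 [d2 H2]]; exists (c1 + c2), (d1 + d2) => x x_ok.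
rewrite mulnDl; apply: leq_add.
  by apply: leq_trans (H1 x x_ok) _; rewrite leq_mul2l leq_pexp2l ?leq_addr ?orbT.
by apply: leq_trans (H2 x x_ok) _; rewrite leq_mul2l leq_pexp2l ?leq_addl ?orbT.
Qed.

Lemma pb_mul h1 h2 : poly_bounded h1 -> poly_bounded h2 ->
  poly_bounded (fun x => h1 x * h2 x).
Proof.
move=> [c1 [d1 H1]] [c2 [d2 H2]]; exists (c1 * c2), (d1 + d2) => x x_ok.
by rewrite expnD mulnACA; apply: leq_mul; [apply: H1|apply: H2].
Qed.

Lemma pb_sub (G' : ctx) (s : car G' -> car G) h :
  (forall y, ok y -> ok (s y)) -> (forall y, ok y -> siz (s y) <= siz y) ->
  poly_bounded h -> poly_bounded (fun y => h (s y)).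
Proof.
move=> s_ok s_siz [c [d H]]; exists c, d => y y_ok.
apply: leq_trans (H _ (s_ok y y_ok)) _.
by rewrite leq_mul2l; case: d {H} => [|d]; rewrite ?expn0 ?leqnn ?leq_exp2r // ?ltnS ?s_siz ?orbT.
Qed.

Lemma pb_poly h (b : {poly nat}) : poly_bounded h ->
  poly_bounded (fun x => b.[h x])%R.
Proof.
move=> hP; elim/poly_ind: b => [|b c IH].
  by apply: pb_le (pb_const 0) _ => x _; rewrite horner0.
apply: pb_le (pb_add (pb_mul IH hP) (pb_const c)) _ => x _.
by rewrite hornerMXaddC.
Qed.

End PolyBounded.

Lemma pb_ext (G : ctx) X (P : car G -> X -> Prop) h :
  poly_bounded h -> poly_bounded (G := ext P) (fun y => h y.1).
Proof. by apply: pb_sub => [y []|]. Qed.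
Arguments pb_ext {G X P h} _.

Section Encodings.
Variable K : realDomainType.

#[export] Instance enc_num : encodable K K := @DNum K.
#[export] Instance enc_unit : encodable K unit := fun _ => DNil.
#[export] Instance enc_boolean : encodable K bool := @of_bool K.
#[export] Instance enc_natural : encodable K nat := @enc_nat K.
#[export] Instance enc_pair (S T : Type) (eS : encodable K S) (eT : encodable K T) :
  encodable K (S * T) := fun p => DCons (enc p.1) (enc p.2).
#[export] Instance enc_list (T : Type) (eT : encodable K T) :
  encodable K (seq T) := @enc_seq K T enc.

End Encodings.

(** * Closure properties of polynomial-time computability *)

Section Computability.
Variables (K : realDomainType) (sz : K -> nat).

Definition segment (p : program) (k : nat) (p1 : program) : Prop :=
  forall i, i < size p1 -> nth ENil p (k + i) = nth ENil p1 i.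

Lemma segment_cat p k p1 p2 : segment p k (p1 ++ p2) ->
  segment p k p1 /\ segment p (k + size p1) p2.
Proof.
move=> H; split=> i ilt.
  by rewrite H ?size_cat ?nth_cat ?ilt // ltn_addr.
by rewrite -addnA H ?size_cat ?ltn_add2l // nth_cat ltnNge leq_addr /= addKn.
Qed.

Lemma segment_cons p k e p1 : segment p k (e :: p1) ->
  nth ENil p k = e /\ segment p k.+1 p1.
Proof.
move=> H; split=> [|i ilt]; first by have := H 0 isT; rewrite addn0.
by have := H i.+1 ilt; rewrite addnS.
Qed.

Section Context.
Variable G : ctx.

(* [E] is the data at hand and [F] the data to compute from it.  The code [p1]
   is relocatable: it works at position [k] of every program containing it
   there.  The time is polynomial in the size parameter of the context, not in
   the size of the data [E], so that polynomial bounds compose without any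
   control on the size of intermediate results. *)
Definition computes (S T : Type) {eS : encodable K S} {eT : encodable K T}
    (E : car G -> S) (F : car G -> T) : Prop :=
  forall k, exists (p1 : program) (e : expr) (tm : car G -> nat),
    poly_bounded tm /\
    forall p, segment p k p1 -> forall x, ok x -> exists2 t,
      eval sz p [:: enc (E x)] e (enc (F x)) t & t <= tm x.

Section Rules.
Context {S : Type} {eS : encodable K S}.
Implicit Types E : car G -> S.

Lemma comp_same T (eT : encodable K T) E (F : car G -> T) :
  (forall x, ok x -> enc (F x) = enc (E x)) -> computes E F.
Proof.
move=> eqF k; exists [::], (EVar 0), (fun=> 1); split; first exact: pb_const.
move=> p _ x x_ok; exists 1 => //; rewrite eqF //.
exact: (EvVar _ _ [:: enc (E x)] 0).
Qed.

Lemma comp_refl E : computes E E.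
Proof. exact: comp_same. Qed.

Lemma comp_eq T (eT : encodable K T) E (F F' : car G -> T) :
  (forall x, ok x -> F' x = F x) -> computes E F -> computes E F'.
Proof.
move=> eqF H k; have [p1 [e [tm [tmP H1]]]] := H k.
exists p1, e, tm; split=> // p sp x x_ok; rewrite eqF //; exact: H1.
Qed.

Lemma comp_enc T (eT : encodable K T) T' (eT' : encodable K T') E
    (F : car G -> T) (F' : car G -> T') :
  (forall x, ok x -> enc (F' x) = enc (F x)) -> computes E F -> computes E F'.
Proof.
move=> eqF H k; have [p1 [e [tm [tmP H1]]]] := H k.
exists p1, e, tm; split=> // p sp x x_ok; rewrite eqF //; exact: H1.
Qed.

(** [e2] is stored as the body of a new function, since a body runs in the environment made of its
    argument alone, and this is the environment for which [FH] provides code. *)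
Lemma comp_trans U (eU : encodable K U) T (eT : encodable K T) E
    (F : car G -> U) (H : car G -> T) :
  computes E F -> computes F H -> computes E H.
Proof.
move=> EF FH k; have [p1 [e1 [tm1 [P1 H1]]]] := EF k.
have [p2 [e2 [tm2 [P2 H2]]]] := FH (k + size p1).
exists (p1 ++ p2 ++ [:: e2]), (ECall (k + size p1 + size p2) e1).
exists (fun x => tm1 x + tm2 x + 1); split.
  by do 2?apply: pb_add => //; apply: pb_const.
move=> p /segment_cat[s1 /segment_cat[s2 /segment_cons[s3 _]]] x x_ok.
have [t1 ev1 le1] := H1 p s1 x x_ok; have [t2 ev2 le2] := H2 p s2 x x_ok.
exists (t1 + t2 + 1); last by lia.
by apply: EvCall; [exact: ev1|rewrite s3].
Qed.

Let comp_unary T (eT : encodable K T) U (eU : encodable K U) E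
    (F : car G -> T) (H : car G -> U) op f :
  (forall p env a v s, eval sz p env a v s -> eval sz p env (op a) (f v) (s + 1)) ->
  (forall x, ok x -> enc (H x) = f (enc (F x))) -> computes E F -> computes E H.
Proof.
move=> evop eqH EF k; have [p1 [e1 [tm1 [P1 H1]]]] := EF k.
exists p1, (op e1), (fun x => tm1 x + 1); split.
  by apply: pb_add => //; apply: pb_const.
move=> p s x x_ok; have [t1 ev1 le1] := H1 p s x x_ok.
exists (t1 + 1); last by lia.
by rewrite eqH //; apply: evop.
Qed.

Lemma comp_hd T (eT : encodable K T) U (eU : encodable K U) E
    (F : car G -> T) (H : car G -> U) :
  (forall x, ok x -> enc (H x) = hd (enc (F x))) -> computes E F -> computes E H.
Proof. exact/comp_unary/EvHd. Qed.

Lemma comp_tl T (eT : encodable K T) U (eU : encodable K U) E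
    (F : car G -> T) (H : car G -> U) :
  (forall x, ok x -> enc (H x) = tl (enc (F x))) -> computes E F -> computes E H.
Proof. exact/comp_unary/EvTl. Qed.

Let comp_binary T1 (e1 : encodable K T1) T2 (e2 : encodable K T2)
    U (eU : encodable K U) E (F1 : car G -> T1) (F2 : car G -> T2)
    (H : car G -> U) op (f : data K -> data K -> data K) (cost : data K -> data K -> nat) :
  (forall p env a b v w s t, eval sz p env a v s -> eval sz p env b w t ->
     eval sz p env (op a b) (f v w) (s + t + cost v w)) ->
  poly_bounded (fun x => cost (enc (F1 x)) (enc (F2 x))) ->
  (forall x, ok x -> enc (H x) = f (enc (F1 x)) (enc (F2 x))) ->
  computes E F1 -> computes E F2 -> computes E H.
Proof.
move=> evop Pc eqH EF1 EF2 k; have [p1 [a1 [tm1 [P1 H1]]]] := EF1 k.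
have [p2 [a2 [tm2 [P2 H2]]]] := EF2 (k + size p1).
exists (p1 ++ p2), (op a1 a2).
exists (fun x => tm1 x + tm2 x + cost (enc (F1 x)) (enc (F2 x))); split.
  by do 2?apply: pb_add.
move=> p /segment_cat[s1 s2] x x_ok.
have [t1 ev1 le1] := H1 p s1 x x_ok; have [t2 ev2 le2] := H2 p s2 x x_ok.
exists (t1 + t2 + cost (enc (F1 x)) (enc (F2 x))); last by lia.
by rewrite eqH //; apply: evop.
Qed.

Lemma comp_cons T1 (e1 : encodable K T1) T2 (e2 : encodable K T2)
    U (eU : encodable K U) E (F1 : car G -> T1) (F2 : car G -> T2) (H : car G -> U) :
  (forall x, ok x -> enc (H x) = DCons (enc (F1 x)) (enc (F2 x))) ->
  computes E F1 -> computes E F2 -> computes E H.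
Proof.
apply: (comp_binary (op := ECons) (f := @DCons K) (cost := fun _ _ => 1)).
  by move=> *; apply: EvCons.
exact: pb_const.
Qed.

Lemma comp_addr E (a b : car G -> K) :
  poly_bounded (fun x => sz (a x)) -> poly_bounded (fun x => sz (b x)) ->
  computes E a -> computes E b -> computes E (fun x => a x + b x)%R.
Proof.
move=> Pa Pb; apply: (comp_binary (op := EAdd) (f := @add_num K)
  (cost := fun v w => num_size sz v + num_size sz w + 1)) => //.
- by move=> p env ea eb v w s t ev1 ev2; rewrite !addnA; apply: EvAdd.
- by do 2?[apply: pb_add => //]; apply: pb_const.
Qed.

Lemma comp_ler E (a b : car G -> K) :
  poly_bounded (fun x => sz (a x)) -> poly_bounded (fun x => sz (b x)) ->
  computes E a -> computes E b -> computes E (fun x => a x <= b x)%R.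
Proof.
move=> Pa Pb; apply: (comp_binary (op := ELe) (f := @le_num K)
  (cost := fun v w => num_size sz v + num_size sz w + 1)) => //.
- by move=> p env ea eb v w s t ev1 ev2; rewrite !addnA; apply: EvLe.
- by do 2?[apply: pb_add => //]; apply: pb_const.
Qed.

Lemma comp_nil U (eU : encodable K U) E (H : car G -> U) :
  (forall x, ok x -> enc (H x) = DNil) -> computes E H.
Proof.
move=> eqH k; exists [::], ENil, (fun=> 1); split; first exact: pb_const.
by move=> p _ x x_ok; exists 1 => //; rewrite eqH //; apply: EvNil.
Qed.

Lemma comp_zero E : computes E (fun _ => 0%R : K).
Proof.
move=> k; exists [::], EZero, (fun=> 1); split; first exact: pb_const.
by move=> p _ x x_ok; exists 1 => //; apply: EvZero.
Qed.

(** Both branches are computable on the whole context, so the sum of their times bounds whichever is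
    taken. *)
Lemma comp_if_node B (eB : encodable K B) T (eT : encodable K T) E
    (c : car G -> B) (F1 F2 H : car G -> T) :
  (forall x, ok x -> H x = if is_node (enc (c x)) then F1 x else F2 x) ->
  computes E c -> computes E F1 -> computes E F2 -> computes E H.
Proof.
move=> eqH Ec EF1 EF2 k; have [p1 [a1 [tm1 [P1 H1]]]] := Ec k.
have [p2 [a2 [tm2 [P2 H2]]]] := EF1 (k + size p1).
have [p3 [a3 [tm3 [P3 H3]]]] := EF2 (k + size p1 + size p2).
exists (p1 ++ p2 ++ p3), (EIf a1 a2 a3).
exists (fun x => tm1 x + (tm2 x + tm3 x) + 1); split.
  by do 2?[apply: pb_add; last exact: pb_const]; apply: pb_add => //; apply: pb_add.
move=> p /segment_cat[s1 /segment_cat[s2 s3]] x x_ok.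
have [t1 ev1 le1] := H1 p s1 x x_ok; have [t2 ev2 le2] := H2 p s2 x x_ok.
have [t3 ev3 le3] := H3 p s3 x x_ok; rewrite eqH //.
exists (t1 + (if is_node (enc (c x)) then t2 else t3) + 1); last by case: ifP; lia.
by apply: EvIf ev1 _; case: ifP.
Qed.

End Rules.
End Context.

(** One round of a loop along [l x]: the current entry and the remaining ones. That they form a
    suffix of [l x] lets bounds on its entries and its length carry over to the round. *)
Definition ext_rec (G : ctx) (T : Type) (l : car G -> seq T) : ctx :=
  ext (fun x (q : T * seq T) => exists s, l x = s ++ q.1 :: q.2).

(** Since [ext_rec] keeps the size parameter, one bound [tb x] serves every round, and the total
    time is this bound times the length of the list. *)
Lemma comp_rec (G : ctx) S (eS : encodable K S) T (eT : encodable K T)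
    U (eU : encodable K U) (E : car G -> S) (l : car G -> seq T)
    (F : car G -> seq T -> U) :
  poly_bounded (fun x => size (l x)) ->
  computes E l -> computes E (fun x => F x [::]) ->
  computes (G := ext_rec l) (fun y => (E y.1, (y.2, F y.1 y.2.2)))
    (fun y => F y.1 (y.2.1 :: y.2.2)) ->
  computes E (fun x => F x (l x)).
Proof.
move=> Pl El E0 ES k; have [pl [al [tml [Ptl Hl]]]] := El k.
have [pz [az [tmz [Ptz Hz]]]] := E0 (k + size pl).
pose f := k + size pl + size pz.
(* Positions [f] and [f.+1] are reserved for the loop and its base case. *)
have [ps [st [tms [[c [d Pts]] Hs]]]] := ES f.+2.
pose v := EVar 0; pose z := f.+1; pose b := f.+2 + size ps.
(* A nonempty list is encoded like the pair of its head and tail. So [ETl v] serves both as the test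
   for nonemptiness and as the component [y.2] of the input to the step. *)
pose body := EIf (ETl v)
  (ECall b (ECons (EHd v) (ECons (ETl v) (ECall f (ECons (EHd v) (ETl (ETl v)))))))
  (ECall z (EHd v)).
exists (pl ++ pz ++ body :: az :: ps ++ [:: st]), (ECall f (ECons v al)).
(* The 20 covers the fixed overhead of a round, which is 17. *)
pose tb (x : car G) := c * (siz x).+1 ^ d + 20.
exists (fun x => tml x + 5 + (tmz x + 10 + size (l x) * tb x)); split.
  apply: pb_add; first by apply: pb_add => //; apply: pb_const.
  apply: pb_add; first by apply: pb_add => //; apply: pb_const.
  apply: pb_mul => //; apply: pb_add; last exact: pb_const.
  by exists c, d.
move=> p /segment_cat[sl /segment_cat[sz0 /segment_cons[fE /segment_cons[zE]]]].
move=> /segment_cat[ss /segment_cons[bE _]] x x_ok; rewrite -/f -/z -/b in fE zE bE ss.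
have ev0 w : eval sz p [:: w] v w 1 by apply: (EvVar _ _ [:: w] 0).
have loop l' : (exists s, l x = s ++ l') ->
    exists2 t, eval sz p [:: DCons (enc (E x)) (enc l')] body (enc (F x l')) t
      & t <= tmz x + 8 + size l' * tb x.
  elim: l' => [|a l' IH] [s ls].
    have [t ev le] := Hz p sz0 x x_ok.
    exists (1 + 1 + (1 + 1 + t + 1) + 1); last by rewrite mul0n; lia.
    apply: EvIf (EvTl (ev0 _)) _ => /=.
    by apply: EvCall (EvHd (ev0 _)) _; rewrite /= zE.
  have [|t ev le] := IH; first by exists (rcons s a); rewrite cat_rcons.
  have y_ok : ok (c := ext_rec l) (x, (a, l')) by split=> //; exists s.
  have [t' ev' le'] := Hs p ss _ y_ok.
  set w := DCons _ _.
  have evr : eval sz p [:: w] (ECall f (ECons (EHd v) (ETl (ETl v)))) (enc (F x l'))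
      (2 + 3 + 1 + t + 1).
    by apply: EvCall (EvCons (EvHd (ev0 _)) (EvTl (EvTl (ev0 _)))) _; rewrite fE.
  exists (2 + ((2 + (2 + (2 + 3 + 1 + t + 1) + 1) + 1) + t' + 1) + 1).
    apply: EvIf (EvTl (ev0 _)) _ => /=; apply: EvCall; last by rewrite bE; apply: ev'.
    exact: EvCons (EvHd (ev0 _)) (EvCons (EvTl (ev0 _)) evr).
  have {le'} := leq_trans le' (Pts _ y_ok); rewrite /= mulSn {1}/tb.
  move: (c * _) (size l' * _) le => m1 m2 le le'. lia.
have [t ev le] := loop (l x) (ex_intro _ [::] erefl).
have [t' ev' le'] := Hl p sl x x_ok.
exists (1 + t' + 1 + t + 1); last by lia.
by apply: EvCall (EvCons (ev0 _) ev') _; rewrite fE.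
Qed.

(** Substitution: facts proved in one context are reused in the body of a loop, provided that the
    size parameter does not grow along [s]. *)
Lemma comp_sub (G G' : ctx) S (eS : encodable K S) S' (eS' : encodable K S')
    T (eT : encodable K T) (s : car G' -> car G) (E' : car G' -> S')
    (E : car G -> S) (F : car G -> T) :
  (forall y, ok y -> ok (s y)) -> (forall y, ok y -> siz (s y) <= siz y) ->
  computes E F ->
  computes E' (fun y => E (s y)) -> computes E' (fun y => F (s y)).
Proof.
move=> s_ok s_siz EF EE'; apply: comp_trans EE' _ => k.
have [p1 [e [tm [tmP H1]]]] := EF k.
exists p1, e, (fun y => tm (s y)); split; first exact: pb_sub tmP.
by move=> p sp y y_ok; apply: H1 => //; apply: s_ok.
Qed.

Lemma comp_ext (G : ctx) X (P : car G -> X -> Prop) S (eS : encodable K S)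
    S' (eS' : encodable K S') T (eT : encodable K T) (E' : car (ext P) -> S')
    (E : car G -> S) (F : car G -> T) :
  computes E F ->
  computes E' (fun y => E y.1) -> computes E' (fun y => F y.1).
Proof. by apply: comp_sub => [y []|]. Qed.

Section Derived.
Variable G : ctx.
Context {S : Type} {eS : encodable K S}.
Implicit Types E : car G -> S.

Lemma comp_pair T (eT : encodable K T) U (eU : encodable K U) E
    (F : car G -> T) (H : car G -> U) :
  computes E F -> computes E H -> computes E (fun x => (F x, H x)).
Proof. exact: comp_cons. Qed.

Lemma comp_fst T (eT : encodable K T) U (eU : encodable K U) E
    (F : car G -> T * U) : computes E F -> computes E (fun x => (F x).1).
Proof. exact: comp_hd. Qed.

Lemma comp_snd T (eT : encodable K T) U (eU : encodable K U) E
    (F : car G -> T * U) : computes E F -> computes E (fun x => (F x).2).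
Proof. exact: comp_tl. Qed.

Lemma comp_ctx_fst T (eT : encodable K T) U (eU : encodable K U) V (eV : encodable K V)
    (A : car G -> T) (B : car G -> U) (F : car G -> V) :
  computes A F -> computes (fun x => (A x, B x)) F.
Proof. by apply: comp_trans; apply: comp_hd (comp_refl _). Qed.

Lemma comp_ctx_snd T (eT : encodable K T) U (eU : encodable K U) V (eV : encodable K V)
    (A : car G -> T) (B : car G -> U) (F : car G -> V) :
  computes B F -> computes (fun x => (A x, B x)) F.
Proof. by apply: comp_trans; apply: comp_tl (comp_refl _). Qed.

Lemma comp_let T (eT : encodable K T) U (eU : encodable K U) E
    (F : car G -> T) (H : car G -> U) :
  computes E F -> computes (fun x => (E x, F x)) H -> computes E H.
Proof. by move=> EF; apply: comp_trans; apply: comp_pair (comp_refl _) EF. Qed.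

Lemma comp_Cons T (eT : encodable K T) E (a : car G -> T) (l : car G -> seq T) :
  computes E a -> computes E l -> computes E (fun x => a x :: l x).
Proof. exact: comp_cons. Qed.

Lemma comp_Nil T (eT : encodable K T) E : computes E (fun _ => [::] : seq T).
Proof. exact: comp_nil. Qed.

Lemma comp_tt E : computes E (fun _ => tt).
Proof. exact: comp_nil. Qed.

Lemma comp_behead T (eT : encodable K T) E (l : car G -> seq T) :
  computes E l -> computes E (fun x => behead (l x)).
Proof. by apply: comp_tl => x _; case: (l x). Qed.

Lemma comp_nilp T (eT : encodable K T) B (eB : encodable K B) E
    (l : car G -> seq T) (F1 F2 : car G -> B) :
  computes E l -> computes E F1 -> computes E F2 ->
  computes E (fun x => if nilp (l x) then F1 x else F2 x).
Proof.
move=> El H1 H2; apply: (comp_if_node (c := l) (F1 := F2) (F2 := F1)) => // x _.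
by case: (l x).
Qed.

Lemma comp_head T (eT : encodable K T) E (a : car G -> T) (l : car G -> seq T) :
  computes E a -> computes E l -> computes E (fun x => head (a x) (l x)).
Proof.
(* Raw data counts as its own encoding, so that the head of a possibly empty list can be named
   without a value of [T] for the empty case. *)
move=> Ea El; pose eD : encodable K (data K) := id.
pose F1 x := hd (@enc K _ (enc_list eT) (l x)); pose F2 x := @enc K _ eT (a x).
refine (comp_enc (T := data K) (F := fun x => if is_node (enc (l x)) then F1 x else F2 x) _ _).
  by move=> x _; rewrite /F1 /F2; case: (l x).
apply: (comp_if_node (T := data K) (c := l) (F1 := F1) (F2 := F2)) => //.
exact: comp_hd El.
Qed.

Lemma comp_true E : computes E (fun _ => true).
Proof. by apply: (comp_cons (F1 := fun=> tt) (F2 := fun=> tt)) => //; apply: comp_tt. Qed.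

Lemma comp_false E : computes E (fun _ => false).
Proof. exact: comp_nil. Qed.

Lemma comp_if T (eT : encodable K T) E (c : car G -> bool) (F1 F2 : car G -> T) :
  computes E c -> computes E F1 -> computes E F2 ->
  computes E (fun x => if c x then F1 x else F2 x).
Proof. by apply: comp_if_node => x _; case: (c x). Qed.

Lemma comp_and E (c1 c2 : car G -> bool) :
  computes E c1 -> computes E c2 -> computes E (fun x => c1 x && c2 x).
Proof. by move=> H1 H2; apply: comp_if => //; apply: comp_false. Qed.

Lemma comp_or E (c1 c2 : car G -> bool) :
  computes E c1 -> computes E c2 -> computes E (fun x => c1 x || c2 x).
Proof. by move=> H1 H2; apply: comp_if => //; apply: comp_true. Qed.

Lemma comp_neg E (c : car G -> bool) :
  computes E c -> computes E (fun x => ~~ c x).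
Proof.
move=> H; apply: (comp_if (F1 := fun=> false) (F2 := fun=> true)) => //.
  exact: comp_false.
exact: comp_true.
Qed.

Lemma comp_0 E : computes E (fun _ => 0).
Proof. exact: comp_nil. Qed.

Lemma comp_S E (m : car G -> nat) : computes E m -> computes E (fun x => (m x).+1).
Proof.
exact: (@comp_cons _ _ _ unit _ nat _ nat _ E (fun=> tt) m
  (fun x => (m x).+1) (fun _ _ => erefl) (comp_tt E)).
Qed.

(** A unary number and a list of units have the same encoding, which turns loops counted by a number
    into loops along a list. *)
Lemma comp_nseq E (m : car G -> nat) :
  computes E m -> computes E (fun x => nseq (m x) tt).
Proof. by apply: comp_enc => x _; elim: (m x) => // i IH; congr DCons. Qed.

End Derived.

Lemma comp_size (G : ctx) S (eS : encodable K S) (E : car G -> S) T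
    (eT : encodable K T) (l : car G -> seq T) :
  poly_bounded (fun x => size (l x)) -> computes E l -> computes E (fun x => size (l x)).
Proof.
move=> Pl El; apply: (comp_rec (F := fun _ s => size s)) => //; first exact: comp_0.
by apply: comp_S; do 2!apply: comp_ctx_snd; apply: comp_refl.
Qed.

End Computability.

(** * List programs *)

Ltac comp_lookup :=
  first [ refine (comp_refl _ _)
        | lazymatch goal with
          | |- @computes _ _ ?G _ _ _ _ (fun y => (@?B y, @?C y)) _ =>
            first [ refine (@comp_ctx_snd _ _ G _ _ _ _ _ _ B C _ _); comp_lookup
                  | refine (@comp_ctx_fst _ _ G _ _ _ _ _ _ B C _ _); comp_lookup ]
          end ].
Ltac comp_proj :=
  first [ solve [comp_lookup]
        | lazymatch goal with
          | |- @computes _ _ ?G _ _ _ _ _ (fun y => fst (@?H y)) =>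
            refine (@comp_fst _ _ G _ _ _ _ _ _ _ H _); comp_proj
          | |- @computes _ _ ?G _ _ _ _ _ (fun y => snd (@?H y)) =>
            refine (@comp_snd _ _ G _ _ _ _ _ _ _ H _); comp_proj
          end ].
Ltac comp_var := cbn [fst snd]; comp_proj.
(* Transports a computability fact to extensions of its context. *)
Ltac comp_hyp H :=
  first [ exact: H | refine (comp_ext H _); comp_var
        | refine (comp_ext (comp_ext H) _); comp_var ].

Fixpoint look (T : Type) (d : T) (u : nat) (l : seq (nat * T)) : T :=
  if l is t :: l' then if t.1 == u then t.2 else look d u l' else d.

Definition argmin (K : realDomainType) (T : Type) (d : T) : seq (K * T) -> K * T :=
  fix argmin l := if l is t :: l' then
    if nilp l' then t else
    if (t.1 <= (argmin l').1)%R then t else argmin l' else (0%R, d).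

Fixpoint down (n : nat) : seq nat := if n is m.+1 then m :: down m else [::].

Fixpoint assignments (colors l : seq nat) : seq (seq (nat * nat)) :=
  if l is w :: l' then
    flatten [seq [seq (w, i) :: a | a <- assignments colors l'] | i <- colors]
  else [:: [::]].

Definition ext_mem (G : ctx) (T : eqType) (l : car G -> seq T) : ctx :=
  ext (fun x t => t \in l x).

Section Lists.
Variables (K : realDomainType) (sz : K -> nat).
Notation computes := (computes sz).

Section Generic.
Context (G : ctx) {S : Type} {eS : encodable K S}.
Implicit Types E : car G -> S.

(** The test drops [n x] entries from a list of length [m x] and looks whether any are left; the
    number of rounds is [n x], whatever [m x] is. *)
Lemma comp_leq E (m n : car G -> nat) :
  poly_bounded n -> computes E m -> computes E n -> computes E (fun x => m x <= n x).
Proof.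
move=> Pn Em En.
apply: (comp_eq (F := fun x => if nilp (nseq (m x - n x) tt) then true else false)).
  by move=> x _; rewrite /nilp size_nseq subn_eq0; case: ifP.
apply: comp_nilp; [|exact: comp_true|exact: comp_false].
apply: (comp_eq (F := fun x => iter (size (nseq (n x) tt)) behead (nseq (m x) tt))).
  move=> x _; rewrite size_nseq; elim: (n x) (m x) => [|i IH] j; first by rewrite subn0.
  by rewrite iterS -IH subnS; case: (j - i).
apply: (comp_rec (l := fun x => nseq (n x) tt)
         (F := fun x s => iter (size s) behead (nseq (m x) tt))).
- by apply: pb_le Pn _ => x _; rewrite size_nseq.
- exact: comp_nseq.
- exact: comp_nseq.
- by apply: comp_behead; comp_var.
Qed.

Lemma comp_pred E (m : car G -> nat) : computes E m -> computes E (fun x => (m x).-1).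
Proof. by apply: comp_tl => x _; case: (m x). Qed.

(* Only one side need be bounded, so that keys of unknown size can be looked up. *)
Lemma comp_eqn E (m n : car G -> nat) : poly_bounded n ->
  computes E m -> computes E n -> computes E (fun x => m x == n x).
Proof.
move=> Pn Em En.
apply: (comp_eq (F := fun x => (m x <= n x) && ((n x <= 0) || ~~ (m x <= (n x).-1)))).
  by move=> x _; case: (n x) => [|i]; rewrite /= ?leqn0 ?andbT // -ltnNge -eqn_leq.
apply: comp_and; first exact: comp_leq.
apply: comp_or; first by apply: comp_leq => //; [exact: pb_const|exact: comp_0].
apply: comp_neg; apply: comp_leq => //; last exact: comp_pred.
by apply: pb_le Pn _ => x _; apply: leq_pred.
Qed.

Lemma comp_cat T (eT : encodable K T) E (l1 l2 : car G -> seq T) :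
  poly_bounded (fun x => size (l1 x)) -> computes E l1 -> computes E l2 ->
  computes E (fun x => l1 x ++ l2 x).
Proof.
move=> P1 E1 E2; apply: (comp_rec (l := l1) (F := fun x s => s ++ l2 x)) => //.
by rewrite /=; apply: comp_Cons; comp_var.
Qed.

Lemma comp_foldr (T : eqType) (eT : encodable K T) U (eU : encodable K U) E
    (l : car G -> seq T) (f : car G -> T -> U -> U) (z : car G -> U) :
  poly_bounded (fun x => size (l x)) -> computes E l -> computes E z ->
  computes (G := ext (fun x q => q.1 \in l x)) (fun y => (E y.1, y.2))
    (fun y => f y.1 y.2.1 y.2.2) ->
  computes E (fun x => foldr (f x) (z x) (l x)).
Proof.
move=> Pl El Ez Ef; apply: (comp_rec (l := l) (F := fun x s => foldr (f x) (z x) s)) => //.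
apply: (comp_sub (G := ext (fun x q => q.1 \in l x)) (E := fun y => (E y.1, y.2))
  (F := fun y => f y.1 y.2.1 y.2.2)
  (s := fun y : car (ext_rec l) => (y.1, (y.2.1, foldr (f y.1) (z y.1) y.2.2)))) => //.
  by move=> y [y_ok [s ls]]; split=> //=; rewrite ls mem_cat mem_head orbT.
by apply: comp_pair; [|apply: comp_pair]; comp_var.
Qed.

End Generic.

Section Generic2.
Context (G : ctx) {S : Type} {eS : encodable K S}.
Implicit Types E : car G -> S.

(** The invariant [P] restricts the states on which a step has to be fast to those that can be
    reached. *)
Lemma comp_iter U (eU : encodable K U) E (n : car G -> nat) (f : car G -> U -> U)
    (z : car G -> U) (P : car G -> U -> Prop) :
  (forall x, ok x -> P x (z x)) -> (forall x u, ok x -> P x u -> P x (f x u)) ->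
  poly_bounded n -> computes E n -> computes E z ->
  computes (G := ext P) (fun y => (E y.1, y.2)) (fun y => f y.1 y.2) ->
  computes E (fun x => iter (n x) (f x) (z x)).
Proof.
move=> Pz Pf Pn En Ez Ef.
apply: (comp_eq (F := fun x => iter (size (nseq (n x) tt)) (f x) (z x))).
  by move=> x _; rewrite size_nseq.
apply: (comp_rec (l := fun x => nseq (n x) tt)
         (F := fun x s => iter (size s) (f x) (z x))) => //.
- by apply: pb_le Pn _ => x _; rewrite size_nseq.
- exact: comp_nseq.
apply: (comp_sub (G := ext P) (E := fun y => (E y.1, y.2)) (F := fun y => f y.1 y.2)
  (s := fun y : car (ext_rec (fun x => nseq (n x) tt)) =>
          (y.1, iter (size y.2.2) (f y.1) (z y.1)))) => //.
  move=> y [y_ok _]; split=> //=.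
  by elim: (size _) => [|i IH] /=; [exact: Pz|exact: Pf].
by apply: comp_pair; comp_var.
Qed.

Lemma comp_map (T : eqType) (eT : encodable K T) U (eU : encodable K U) E
    (l : car G -> seq T) (f : car G -> T -> U) :
  poly_bounded (fun x => size (l x)) -> computes E l ->
  computes (G := ext_mem l) (fun y => (E y.1, y.2)) (fun y => f y.1 y.2) ->
  computes E (fun x => [seq f x t | t <- l x]).
Proof.
move=> Pl El Ef; apply: (comp_foldr (f := fun x t r => f x t :: r)) => //.
  exact: comp_Nil.
apply: comp_Cons; last by comp_var.
apply: (comp_sub (G := ext_mem l) (E := fun y => (E y.1, y.2)) (F := fun y => f y.1 y.2)
  (s := fun y : car (ext _) => (y.1, y.2.1))) => //.
by apply: comp_pair; comp_var.
Qed.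

Lemma comp_filter (T : eqType) (eT : encodable K T) E
    (l : car G -> seq T) (p : car G -> T -> bool) :
  poly_bounded (fun x => size (l x)) -> computes E l ->
  computes (G := ext_mem l) (fun y => (E y.1, y.2)) (fun y => p y.1 y.2) ->
  computes E (fun x => [seq t <- l x | p x t]).
Proof.
move=> Pl El Ef; apply: (comp_foldr (f := fun x t r => if p x t then t :: r else r)) => //.
  exact: comp_Nil.
apply: comp_if; [|apply: comp_Cons|]; try comp_var.
apply: (comp_sub (G := ext_mem l) (E := fun y => (E y.1, y.2)) (F := fun y => p y.1 y.2)
  (s := fun y : car (ext _) => (y.1, y.2.1))) => //.
by apply: comp_pair; comp_var.
Qed.

Lemma comp_has (T : eqType) (eT : encodable K T) E
    (l : car G -> seq T) (p : car G -> T -> bool) :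
  poly_bounded (fun x => size (l x)) -> computes E l ->
  computes (G := ext_mem l) (fun y => (E y.1, y.2)) (fun y => p y.1 y.2) ->
  computes E (fun x => has (p x) (l x)).
Proof.
move=> Pl El Ef.
apply: (comp_eq (F := fun x => foldr (fun t r => p x t || r) false (l x))) => //.
apply: (comp_foldr (f := fun x t r => p x t || r)) => //.
  exact: comp_false.
apply: comp_or; last comp_var.
apply: (comp_sub (G := ext_mem l) (E := fun y => (E y.1, y.2)) (F := fun y => p y.1 y.2)
  (s := fun y : car (ext _) => (y.1, y.2.1))) => //.
by apply: comp_pair; comp_var.
Qed.

Lemma comp_flatten (T : eqType) (eT : encodable K T) E (l : car G -> seq (seq T)) :
  poly_bounded (fun x => size (l x)) ->
  poly_bounded (G := ext_mem l) (fun y => size y.2) -> computes E l ->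
  computes E (fun x => flatten (l x)).
Proof.
move=> Pl Pl' El; apply: (comp_foldr (f := fun x t r => t ++ r)) => //.
  exact: comp_Nil.
apply: comp_cat; try comp_var.
exact: (pb_sub (G := ext_mem l) (s := fun y : car (ext _) => (y.1, y.2.1))) Pl'.
Qed.

Lemma comp_look T (eT : encodable K T) E (d : car G -> T) (u : car G -> nat)
    (l : car G -> seq (nat * T)) :
  poly_bounded u -> poly_bounded (fun x => size (l x)) ->
  computes E d -> computes E u -> computes E l ->
  computes E (fun x => look (d x) (u x) (l x)).
Proof.
move=> Pu Pl Ed Eu El; apply: (comp_rec (F := fun x s => look (d x) (u x) s)) => //=.
apply: comp_if; try comp_var.
by apply: comp_eqn; [exact: pb_ext|comp_var|comp_hyp Eu].
Qed.

Lemma comp_mem E (u : car G -> nat) (l : car G -> seq nat) :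
  poly_bounded u -> poly_bounded (fun x => size (l x)) ->
  computes E u -> computes E l -> computes E (fun x => u x \in l x).
Proof.
move=> Pu Pl Eu El; apply: (comp_eq (F := fun x => has (fun t => t == u x) (l x))).
  by move=> x _; rewrite -has_pred1.
apply: (comp_has (p := fun x t => t == u x)) => //.
by apply: comp_eqn; [exact: pb_ext|comp_var|comp_hyp Eu].
Qed.

Lemma pb_ext_rec T (l : car G -> seq T) : poly_bounded (fun x => size (l x)) ->
  poly_bounded (G := ext_rec l) (fun y => size y.2.2).
Proof.
move=> P; refine (pb_le (pb_ext P) _) => -[x [a s]] [_ [s' /= ->]].
by rewrite size_cat /=; lia.
Qed.

Lemma comp_down E (n : car G -> nat) :
  poly_bounded n -> computes E n -> computes E (fun x => down (n x)).
Proof.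
move=> Pn En; apply: (comp_eq (F := fun x => down (size (nseq (n x) tt)))).
  by move=> x _; rewrite size_nseq.
have P : poly_bounded (fun x => size (nseq (n x) tt)).
  by apply: pb_le Pn _ => x _; rewrite size_nseq.
apply: (comp_rec (l := fun x => nseq (n x) tt) (F := fun x s => down (size s))) => //.
- exact: comp_nseq.
- exact: comp_Nil.
rewrite /=; apply: comp_Cons; last by comp_var.
apply: comp_size; last by comp_var.
exact: pb_ext_rec.
Qed.

Lemma comp_rev T (eT : encodable K T) E (l : car G -> seq T) :
  poly_bounded (fun x => size (l x)) -> computes E l -> computes E (fun x => rev (l x)).
Proof.
move=> Pl El; apply: (comp_rec (F := fun x s => rev s)) => //.
  exact: comp_Nil.
apply: (comp_eq (F := fun y : car (ext_rec l) => rev y.2.2 ++ [:: y.2.1])).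
  by move=> y _; rewrite rev_cons cats1.
apply: comp_cat; last by apply: comp_Cons; [comp_var|exact: comp_Nil].
  refine (pb_le (pb_ext_rec Pl) _) => y _; by rewrite size_rev.
by comp_var.
Qed.

Definition pairs (T : Type) (s : seq T) := zip s (behead s).
Definition triples (T : Type) (s : seq T) := zip s (zip (behead s) (behead (behead s))).

Lemma comp_pairs E (l : car G -> seq nat) :
  poly_bounded (fun x => size (l x)) -> computes E l -> computes E (fun x => pairs (l x)).
Proof.
move=> Pl El; apply: (comp_rec (F := fun x s => pairs s)) => //.
  exact: comp_Nil.
apply: (comp_eq (F := fun y : car (ext_rec l) =>
  if nilp y.2.2 then [::] else (y.2.1, head 0 y.2.2) :: pairs y.2.2)).
  by move=> [x [a []]].
apply: comp_nilp; [comp_var|exact: comp_Nil|].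
apply: comp_Cons; last by comp_var.
by apply: comp_pair; [comp_var|apply: comp_head; [exact: comp_0|comp_var]].
Qed.

Lemma comp_triples E (l : car G -> seq nat) :
  poly_bounded (fun x => size (l x)) -> computes E l -> computes E (fun x => triples (l x)).
Proof.
move=> Pl El; apply: (comp_rec (F := fun x s => triples s)) => //.
  exact: comp_Nil.
apply: (comp_eq (F := fun y : car (ext_rec l) =>
  if nilp (behead y.2.2) then [::] else
  (y.2.1, (head 0 y.2.2, head 0 (behead y.2.2))) :: triples y.2.2)).
  by move=> [x [a [|b []]]].
apply: comp_nilp; [by apply: comp_behead; comp_var|exact: comp_Nil|].
apply: comp_Cons; last by comp_var.
apply: comp_pair; first by comp_var.
apply: comp_pair; apply: comp_head; try exact: comp_0; first by comp_var.
by apply: comp_behead; comp_var.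
Qed.

End Generic2.

Section Generic3.
Context (G : ctx) {S : Type} {eS : encodable K S}.
Implicit Types E : car G -> S.

Lemma comp_uniq E (l : car G -> seq nat) : poly_bounded (fun x => size (l x)) ->
  poly_bounded (G := ext_mem l) (fun y => y.2) ->
  computes E l -> computes E (fun x => uniq (l x)).
Proof.
move=> Pl Pl' El; apply: (comp_rec (F := fun x s => uniq s)) => //.
  exact: comp_true.
rewrite /=; apply: comp_and; last by comp_var.
apply: comp_neg; apply: comp_mem; try comp_var; last exact: pb_ext_rec.
apply: (pb_sub (G := ext_mem l) (s := fun y : car (ext_rec l) => (y.1, y.2.1))) Pl' => //.
by move=> y [y_ok [s ls]]; split=> //=; rewrite ls mem_cat mem_head orbT.
Qed.

Lemma size_assignments colors l :
  size (assignments colors l) = size colors ^ size l.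
Proof.
elim: l => //= w l IH; rewrite size_flatten /shape -map_comp.
rewrite (eq_map (g := fun=> size (assignments colors l))); last first.
  by move=> i /=; rewrite size_map.
by rewrite IH expnS; move: (_ ^ _) => m; elim: (colors) => //= a s ->; rewrite mulSn.
Qed.

Lemma comp_assignments E (colors l : car G -> seq nat) :
  poly_bounded (fun x => size (colors x)) -> poly_bounded (fun x => size (l x)) ->
  poly_bounded (fun x => size (colors x) ^ size (l x)) ->
  computes E colors -> computes E l ->
  computes E (fun x => assignments (colors x) (l x)).
Proof.
move=> Pc Pl Pa Ec El; apply: (comp_rec (F := fun x s => assignments (colors x) s)) => //.
  by apply: comp_Cons; [exact: comp_Nil|exact: comp_Nil].
have Pa' : poly_bounded (G := ext_rec l)
    (fun y => size (assignments (colors y.1) y.2.2)).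
  (* For a suffix [s] of [l x] the power has a smaller exponent, hence a smaller value unless the
     base is 0; the added 1 covers [0 ^ 0]. *)
  refine (pb_le (pb_add (pb_const _ 1) (pb_ext Pa)) _) => -[x [a s]] [_ [s' /= ->]].
  rewrite size_assignments size_cat /=; case: (size (colors x)) => [|c].
    by case: (size s) => [|i]; [rewrite expn0 leq_addr|rewrite exp0n].
  by apply: leq_trans (leq_addl _ _); rewrite leq_pexp2l //; lia.
rewrite /=; apply: (comp_flatten (l := fun y : car (ext_rec l) =>
  [seq [seq (y.2.1, i) :: a | a <- assignments (colors y.1) y.2.2] | i <- colors y.1])).
- by refine (pb_le (pb_ext Pc) _) => y _; rewrite size_map.
- by refine (pb_le (pb_ext Pa') _) => -[y r] [_ /mapP[i _ /= ->]]; rewrite size_map.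
apply: (comp_map (l := fun y : car (ext_rec l) => colors y.1)
  (f := fun y i => [seq (y.2.1, i) :: a | a <- assignments (colors y.1) y.2.2])).
- exact: (pb_ext Pc).
- by comp_hyp Ec.
pose GC := ext_mem (fun y : car (ext_rec l) => colors y.1).
apply: (comp_map (f := fun (z : car GC) a => (z.1.2.1, z.2) :: a)).
- exact: (pb_ext Pa').
- by comp_var.
by apply: comp_Cons; [apply: comp_pair|]; comp_var.
Qed.

End Generic3.

End Lists.

(** * Dynamic programming on a rooted tree *)

(* An order [o] lists the pairs (child, parent) of a tree on 0, ..., n - 1 rooted
   at 0, each vertex before its parent.  The root gets the virtual parent n, and
   the virtual edge above it a color like any other edge; the color of an edge is
   attached to its lower end.  Assignments are association lists child |-> color. *)
Definition children (o : seq (nat * nat)) (v : nat) : seq nat :=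
  [seq e.1 | e <- o & e.2 == v].

Section Algorithm.
Variable K : realDomainType.

Definition tcost (tb : seq (seq K)) (i j : nat) : K := nth 0%R (nth [::] tb i) j.

(** A triple [(u, (v, w))] stands for the traversal from edge uv to edge vw. The list [a] gives the
    colors of the edges at [v], keyed by their other ends, parent included. *)
Definition local_cost (tr : seq (nat * (nat * nat))) (tb : seq (seq K)) (v : nat)
    (a : seq (nat * nat)) : K :=
  (\sum_(t <- tr) if t.2.1 == v then tcost tb (look 0%N t.1 a) (look 0%N t.2.2 a) else 0)%R.

Definition table_type := seq (nat * seq (nat * (K * seq (nat * nat)))).

Definition entry (tab : table_type) (v c : nat) : K * seq (nat * nat) :=
  look (0%R, [::]) c (look [::] v tab).

Definition candidate_cost tr tb (tab : table_type) (v p c : nat) (a : seq (nat * nat)) : K :=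
  (local_cost tr tb v ((p, c) :: a) + \sum_(t <- a) (entry tab t.1 t.2).1)%R.

Definition best_row C tr tb o (tab : table_type) (v p : nat) :=
  [seq (c, argmin [::] [seq (candidate_cost tr tb tab v p c a, a)
     | a <- assignments (down C) (children o v) & uniq (c :: [seq t.2 | t <- a])])
  | c <- down C].

(* [q] lists parents before children, so the recursion fills in children first. *)
Fixpoint table C tr tb o (q : seq (nat * nat)) : table_type :=
  if q is e :: q' then
    let tab := table C tr tb o q' in (e.1, best_row C tr tb o tab e.1 e.2) :: tab
  else [::].

Definition root_color C (tab : table_type) : nat :=
  (argmin 0%N [seq ((entry tab 0 c).1, c) | c <- down C]).2.

Definition child_colors (r : seq (nat * nat * nat)) := [seq (x.1.1, x.2) | x <- r].

(** The recursion handles the tail of [o] first, hence parents before children. The root never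
    occurs as a child, so looking it up yields the default [c0], its own color. *)
Fixpoint recolor (tab : table_type) (c0 : nat) (o : seq (nat * nat)) :
    seq (nat * nat * nat) :=
  if o is e :: o' then
    let r := recolor tab c0 o' in
    (e, look 0%N e.1 (entry tab e.2 (look c0 e.2 (child_colors r))).2) :: r
  else [::].

End Algorithm.

(** * Association lists, assignments and minima *)

Section Lookup.
Variables (T : Type).

Lemma look_cons (d : T) u t l :
  look d u (t :: l) = if t.1 == u then t.2 else look d u l.
Proof. by []. Qed.

Lemma look_notin (d : T) u l : u \notin [seq t.1 | t <- l] -> look d u l = d.
Proof.
by elim: l => //= t l IH; rewrite inE negb_or eq_sym => /andP[/negPf-> /IH].
Qed.

Lemma look_graph (l : seq nat) (h : nat -> T) (d : T) u :
  u \in l -> look d u [seq (w, h w) | w <- l] = h u.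
Proof. by elim: l => //= w l IH; rewrite inE eq_sym; case: eqP => [->|_ /IH]. Qed.

Lemma map_fst_graph (l : seq nat) (h : nat -> T) : [seq t.1 | t <- [seq (w, h w) | w <- l]] = l.
Proof. by elim: l => //= w l ->. Qed.

Lemma map_snd_graph (l : seq nat) (h : nat -> T) :
  [seq t.2 | t <- [seq (w, h w) | w <- l]] = [seq h w | w <- l].
Proof. by rewrite -map_comp. Qed.

End Lookup.

Lemma graph_look (d : nat) (a : seq (nat * nat)) : uniq [seq t.1 | t <- a] ->
  [seq (w, look d w a) | w <- [seq t.1 | t <- a]] = a.
Proof.
elim: a => //= -[w i] a IH /= /andP[wa /IH E]; rewrite eqxx; congr cons.
rewrite -[RHS]E; apply/eq_in_map => u ua /=; case: eqP => // wu.
by rewrite wu ua in wa.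
Qed.

Lemma mem_look (d : nat) (a : seq (nat * nat)) u : u \in [seq t.1 | t <- a] ->
  (u, look d u a) \in a.
Proof.
elim: a => //= -[w i] a IH /=; rewrite !inE [u == w]eq_sym.
by case: eqP => [->|_ /= /IH ->]; rewrite ?eqxx ?orbT.
Qed.

Lemma mem_down n i : (i \in down n) = (i < n).
Proof. by elim: n => [|n IH] //; rewrite /= inE IH ltnS [RHS]leq_eqVlt. Qed.

Lemma size_down n : size (down n) = n.
Proof. by elim: n => //= n ->. Qed.

Lemma uniq_down n : uniq (down n).
Proof. by elim: n => //= n ->; rewrite mem_down ltnn. Qed.

Lemma mem_assignments colors l a : (a \in assignments colors l) =
  ([seq t.1 | t <- a] == l) && all (fun t => t.2 \in colors) a.
Proof.
elim: l a => [|w l IH] a.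
  by rewrite /= inE; case: a.
apply/idP/idP => /=.
  move=> /flattenP[s /mapP[i ic ->] /mapP[b]]; rewrite IH => /andP[/eqP bl bc] ->.
  by rewrite /= bl eqxx ic bc.
case: a => [|[u i] a] //= /andP[/eqP[-> al] /andP[ic ac]].
apply/flattenP; exists [seq (w, i) :: b | b <- assignments colors l].
  by apply/mapP; exists i.
by apply/map_f; rewrite IH al eqxx.
Qed.

Lemma argmin_mem (K : realDomainType) (T : eqType) (d : T) (l : seq (K * T)) :
  l != [::] -> argmin d l \in l.
Proof.
elim: l => //= t l IH _; case: l IH => [|u l] IH; first by rewrite mem_head.
rewrite [nilp _]/=; case: ifP => _; first by rewrite mem_head.
by rewrite inE IH ?orbT.
Qed.

Lemma argmin_le (K : realDomainType) (T : eqType) (d : T) (l : seq (K * T)) t :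
  t \in l -> ((argmin d l).1 <= t.1)%R.
Proof.
elim: l t => // u l IH t; rewrite inE.
case: l IH => [|w l] IH; first by rewrite orbF => /eqP->.
have -> : argmin d [:: u, w & l] = if (u.1 <= (argmin d (w :: l)).1)%R then u
  else argmin d (w :: l) by [].
case: (lerP u.1 (argmin d (w :: l)).1) => [le|lt] /orP[/eqP->|/IH] //; first exact: le_trans.
exact: ltW.
Qed.

Lemma sum_if_eq (V : nmodType) (T : eqType) (s : seq T) (v : T) (x : V) :
  v \in s -> uniq s -> (\sum_(i <- s) (if i == v then x else 0) = x)%R.
Proof.
move=> vs us; rewrite (bigD1_seq v) //= eqxx big1 ?addr0 // => i.
by move/negPf->.
Qed.

Section SumSize.
Variables (K : realDomainType) (g : K -> nat).
Hypothesis gD : forall x y, g (x + y)%R <= g x + g y.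

(** The term [g 0] pays for the empty sum. *)
Lemma size_sum (T : Type) (s : seq T) (F : T -> K) :
  g (\sum_(t <- s) F t)%R <= g 0%R + \sum_(t <- s) g (F t).
Proof.
elim: s => [|t s IH]; first by rewrite !big_nil addn0.
by rewrite !big_cons addnCA; apply: leq_trans (gD _ _) _; rewrite leq_add2l.
Qed.

Lemma size_sum_le (T : eqType) (s : seq T) (F : T -> K) B :
  (forall t, t \in s -> g (F t) <= B) -> g (\sum_(t <- s) F t)%R <= g 0%R + size s * B.
Proof.
move=> le; apply: leq_trans (size_sum _ _) _; rewrite leq_add2l.
rewrite big_seq; apply: leq_trans (leq_sum _ le) _.
by rewrite -big_seq big_const_seq count_predT iter_addn_0 mulnC.
Qed.

End SumSize.

(** * Bellman equation and optimality of the computed numbering *)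

Section Optimality.
Variables (K : realDomainType) (n C : nat) (tr : seq (nat * (nat * nat))).
Variables (tb : seq (seq K)) (o : seq (nat * nat)).
Let keys := 0 :: [seq e.1 | e <- o].
Let bo := (0, n) :: rev o.
Hypothesis keys_uniq : uniq keys.
Hypothesis parent_later : forall o1 e o2, o = o1 ++ e :: o2 ->
  e.2 \in 0 :: [seq e.1 | e <- o2].
Hypothesis few_children : forall v, v \in keys -> size (children o v) < C.

Lemma keys_bo : [seq e.1 | e <- bo] = 0 :: rev [seq e.1 | e <- o].
Proof. by rewrite /= map_rev. Qed.

Lemma mem_keys_bo v : (v \in [seq e.1 | e <- bo]) = (v \in keys).
Proof. by rewrite keys_bo !inE mem_rev. Qed.

Lemma uniq_keys_bo : uniq [seq e.1 | e <- bo].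
Proof. by rewrite keys_bo /= mem_rev rev_uniq. Qed.

Lemma mem_children v w : (w \in children o v) = ((w, v) \in o).
Proof.
apply/mapP/idP => [[[w' v'] /=]|wv]; last by exists (w, v) => //; rewrite mem_filter eqxx.
by rewrite mem_filter /= => /andP[/eqP-> wv ->].
Qed.

Lemma uniq_children v : uniq (children o v).
Proof.
have /andP[_] := keys_uniq; rewrite /children; apply: subseq_uniq.
by apply: map_subseq; apply: filter_subseq.
Qed.

Lemma parent_in_keys w v : (w, v) \in o -> v \in keys.
Proof.
move=> wv; have [o1 [o2 oE]] : exists o1 o2, o = o1 ++ (w, v) :: o2.
  by case/splitPr: wv => o1 o2; exists o1, o2.
have := parent_later oE; rewrite /keys oE !inE map_cat mem_cat /= inE.
by case/orP => ->; rewrite ?orbT.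
Qed.

Lemma child_in_keys w v : (w, v) \in o -> w \in keys.
Proof. by move/(map_f (fun e => e.1)) => wo; rewrite inE wo orbT. Qed.

(** Each pair of [o] is visited once by the double sum, namely at its parent, which occurs exactly
    once among the keys of [bo]. *)
Lemma sum_children (F : nat -> K) :
  (\sum_(e <- bo) \sum_(w <- children o e.1) F w = \sum_(e <- o) F e.1)%R.
Proof.
pose G v := (\sum_(e <- o) if v == e.2 then F e.1 else 0)%R.
rewrite (eq_bigr (fun e => G e.1)) => [|e _]; last first.
  rewrite /G /children big_map big_filter -big_mkcond.
  by apply: eq_bigl => e'; rewrite eq_sym.
rewrite -(big_map (fun e => e.1) xpredT G) exchange_big big_seq [RHS]big_seq /=.
apply: eq_bigr => -[w v] /= /parent_in_keys vk.
apply: (@sum_if_eq _ _ [seq e.1 | e <- bo]); last exact: uniq_keys_bo.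
by rewrite mem_keys_bo.
Qed.

(** Reversing [o] puts every parent before its children. As keys are distinct, comparing positions
    places the children in the part after the parent. *)
Lemma children_later q1 e q : bo = q1 ++ e :: q ->
  {subset children o e.1 <= [seq e.1 | e <- q]}.
Proof.
case: e => v p E w; rewrite mem_children => /= wv.
have [o1 [o2 oE]] : exists o1 o2, o = o1 ++ (w, v) :: o2.
  by case/splitPr: wv => o1 o2; exists o1, o2.
have vo2 := parent_later oE; have u := uniq_keys_bo.
pose s := [seq e.1 | e <- bo].
have : index v s < index w s.
  have sE : s = (0 :: [seq e.1 | e <- rev o2]) ++ w :: [seq e.1 | e <- rev o1].
    by rewrite /s /= oE rev_cat rev_cons cat_rcons map_cat.
  have v2 : v \in 0 :: [seq e.1 | e <- rev o2] by move: vo2; rewrite map_rev !inE mem_rev.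
  move: u; rewrite -/s sE; move: (0 :: _) v2 => A vA; rewrite cat_uniq.
  case/and3P=> _ /hasPn /(_ w (mem_head _ _)) /negPf wA _.
  by rewrite !index_cat vA wA /= eqxx addn0 index_mem.
rewrite /s E map_cat /=; have := u; rewrite E map_cat /= cat_uniq /=.
case/and3P=> _; rewrite negb_or => /andP[vq1 _] _.
have : w \in s by rewrite mem_keys_bo inE oE map_cat mem_cat /= mem_head !orbT.
rewrite /s E map_cat /= !index_cat /= eqxx (negPf vq1) mem_cat inE addn0.
case: ifP => [wq1 _|_ /=]; first by rewrite ltnNge index_size.
by case: eqP => [<-|_ //]; rewrite eqxx addn0 ltnn.
Qed.

Local Notation tab := (table C tr tb o bo).

Lemma look_table q1 q w : uniq [seq e.1 | e <- q1 ++ q] -> w \in [seq e.1 | e <- q] ->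
  look [::] w (table C tr tb o (q1 ++ q)) = look [::] w (table C tr tb o q).
Proof.
elim: q1 => //= e q1 IH /andP[eq u] wq; rewrite -IH //.
by case: eqP eq => // ->; rewrite map_cat mem_cat wq orbT.
Qed.

Lemma row_ext (t1 t2 : table_type K) v p :
  {in children o v, forall w, look [::] w t1 = look [::] w t2} ->
  best_row C tr tb o t1 v p = best_row C tr tb o t2 v p.
Proof.
move=> eq12; apply: eq_map => c; congr (_, argmin _ _).
apply/eq_in_map => a; rewrite mem_filter mem_assignments => /and3P[_ /eqP ach _].
congr (_ + _, _)%R; apply: eq_big_seq => t ta; rewrite /entry eq12 //.
by rewrite -ach; apply: map_f.
Qed.

(** A row is computed from the rows of later vertices only, but these include the children, and rows
    added afterwards have other keys. So the finished table satisfies the recursion with itself on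
    both sides. *)
Lemma look_tab v p : (v, p) \in bo -> look [::] v tab = best_row C tr tb o tab v p.
Proof.
move=> vp; have [q1 [q boE]] : exists q1 q, bo = q1 ++ (v, p) :: q.
  by case/splitPr: vp => q1 q; exists q1, q.
have u := uniq_keys_bo; rewrite boE in u.
rewrite {1}boE look_table //; last by rewrite /= mem_head.
rewrite [LHS]/= eqxx; apply: row_ext => w wv.
have wq := children_later boE wv.
rewrite boE -cat_rcons look_table ?cat_rcons //.
Qed.

Definition assignment v c a :=
  [&& [seq t.1 | t <- a] == children o v, all (fun t => t.2 < C) a
    & uniq (c :: [seq t.2 | t <- a])].

(** Removing [c] leaves [C - 1] colors, at least as many as there are children. *)
Lemma assignment_exists v c : v \in keys -> c < C -> exists a, assignment v c a.
Proof.
move=> vk cC; pose cs := take (size (children o v)) (rem c (down C)).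
have size_cs : size cs = size (children o v).
  rewrite size_takel // size_rem ?mem_down // size_down.
  by rewrite -ltnS prednK ?few_children //; apply: leq_ltn_trans cC.
have csP i : i \in cs -> (i != c) && (i < C).
  by move/mem_take; rewrite mem_rem_uniq ?uniq_down // inE mem_down.
exists (zip (children o v) cs); have zip2 : [seq t.2 | t <- zip (children o v) cs] = cs.
  by rewrite -/(unzip2 _) unzip2_zip ?size_cs.
rewrite /assignment -/(unzip1 _) unzip1_zip ?size_cs // eqxx /= zip2; apply/and3P; split.
- rewrite -(all_map (fun t => t.2) (fun i => i < C)) zip2.
  by apply/allP=> i /csP /andP[].
- by apply/negP => /csP; rewrite eqxx.
- by rewrite take_uniq // rem_uniq // uniq_down.
Qed.

Lemma entry_argmin v p c (e := entry tab v c) : (v, p) \in bo -> c < C ->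
  [/\ assignment v c e.2, e.1 = candidate_cost tr tb tab v p c e.2
    & forall a, assignment v c a -> (e.1 <= candidate_cost tr tb tab v p c a)%R].
Proof.
move=> vp cC; have vk : v \in keys.
  by rewrite -mem_keys_bo; apply: (map_f (fun e => e.1) vp).
pose cands := [seq (candidate_cost tr tb tab v p c a, a)
     | a <- assignments (down C) (children o v) & uniq (c :: [seq t.2 | t <- a])].
have -> : e = argmin [::] cands.
  rewrite /e /entry (look_tab vp) /best_row.
  by rewrite (look_graph (fun c => argmin _ _)) ?mem_down.
have candsP a : assignment v c a = (a \in [seq a <- assignments (down C) (children o v)
    | uniq (c :: [seq t.2 | t <- a])]).
  rewrite mem_filter mem_assignments andbC -andbA; congr [&& _, _ & _].
  by apply: eq_all => t; rewrite mem_down.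
(* Existence of an assignment keeps [argmin] off its default, whose cost 0 would be spurious. *)
have [a0 Pa0] := assignment_exists vk cC.
have : argmin [::] cands \in cands.
  apply: argmin_mem; move: Pa0; rewrite candsP /cands.
  by case: (filter _ _).
case/mapP=> a; rewrite -candsP => Pa aE; split; [by rewrite aE|by rewrite aE|move=> b Pb].
apply: (@argmin_le _ _ [::] cands (candidate_cost tr tb tab v p c b, b)).
apply/mapP; exists b => //.
by rewrite -candsP.
Qed.

Definition coloring_cost (k : nat -> nat) : K := (\sum_(e <- bo)
  local_cost tr tb e.1 ((e.2, k e.1) :: [seq (w, k w) | w <- children o e.1]))%R.

Definition proper_numbering (k : nat -> nat) := forall v, v \in keys ->
  k v < C /\ uniq (k v :: [seq k w | w <- children o v]).

Lemma sum_entries (k : nat -> nat) :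
  (\sum_(e <- bo) (entry tab e.1 (k e.1)).1 =
  (entry tab 0 (k 0)).1 +
  \sum_(e <- bo) \sum_(w <- children o e.1) (entry tab w (k w)).1)%R.
Proof.
rewrite sum_children big_cons; congr (_ + _)%R.
by apply: perm_big; rewrite perm_rev.
Qed.

(* Summing the Bellman inequalities over all vertices, every entry but that of
   the root occurs once as a vertex and once as a child. *)
Lemma entry_root_le k : proper_numbering k -> ((entry tab 0 (k 0)).1 <= coloring_cost k)%R.
Proof.
move=> Pk; have := sum_entries k.
set S := (\sum_(e <- bo) \sum_(w <- _) _)%R => eqS.
rewrite -(lerD2r S) -eqS /coloring_cost /S -big_split /= big_seq [leRHS]big_seq.
apply: ler_sum => -[v p] /= vp.
have vk : v \in keys by rewrite -mem_keys_bo; apply: (map_f (fun e => e.1) vp).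
have [kv uk] := Pk v vk; have [_ _ minE] := entry_argmin vp kv.
apply: le_trans (minE [seq (w, k w) | w <- children o v] _) _.
  rewrite /assignment map_fst_graph map_snd_graph eqxx uk andbT /=.
  by apply/allP => t /mapP[w /[!mem_children] /child_in_keys/Pk[kw _] ->].
by rewrite /candidate_cost big_map.
Qed.

(** If the colors below every vertex are the stored minimizer, each Bellman inequality is an
    equality, and the same cancellation leaves the value at the root. *)
Lemma coloring_cost_tight k :
  (forall v, v \in keys -> [seq (w, k w) | w <- children o v] = (entry tab v (k v)).2) ->
  (forall v, v \in keys -> k v < C) ->
  coloring_cost k = (entry tab 0 (k 0)).1 /\ proper_numbering k.
Proof.
move=> kE kC; split.
  have := sum_entries k.
  set S := (\sum_(e <- bo) \sum_(w <- _) _)%R => eqS.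
  apply: (addIr S); rewrite -eqS /coloring_cost /S -big_split /=.
  rewrite big_seq [RHS]big_seq; apply: eq_bigr => -[v p] /= vp.
  have vk : v \in keys by rewrite -mem_keys_bo; apply: (map_f (fun e => e.1) vp).
  have [_ -> _] := entry_argmin vp (kC v vk).
  by rewrite -kE // /candidate_cost [in RHS]big_map.
move=> v vk; split; first exact: kC.
have : v \in [seq e.1 | e <- bo] by rewrite mem_keys_bo.
case/mapP=> -[v' p] /= vp vE; rewrite -{v'}vE in vp.
have [/and3P[_ _ ]] := entry_argmin vp (kC v vk).
by rewrite -kE // -map_comp.
Qed.


Definition color_of (c0 : nat) (r : seq (nat * nat * nat)) (w : nat) : nat :=
  look c0 w (child_colors r).

Let k := color_of (root_color C tab) (recolor tab (root_color C tab) o).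

Lemma map_recolor (t : table_type K) c0 s : [seq x.1 | x <- recolor t c0 s] = s.
Proof. by elim: s => //= e s ->. Qed.

Lemma map_child_colors (t : table_type K) c0 s :
  [seq x.1 | x <- child_colors (recolor t c0 s)] = [seq e.1 | e <- s].
Proof. by rewrite -[in RHS](map_recolor t c0 s) -!map_comp. Qed.

(** [recolor] only adds entries for new children in front, so colors already fixed nearer the root
    do not change. That 0 is no child protects the default giving the root its color. *)
Lemma color_of_cat (t : table_type K) c0 s1 s2 w : uniq (0 :: [seq e.1 | e <- s1 ++ s2]) ->
  w \in 0 :: [seq e.1 | e <- s2] ->
  color_of c0 (recolor t c0 (s1 ++ s2)) w = color_of c0 (recolor t c0 s2) w.
Proof.
elim: s1 => // e s1 IH u ws2; have /= /andP[n0 /andP[es us]] := u.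
rewrite -IH //; last first.
  by rewrite /= us andbT; apply: contra n0; rewrite inE => ->; rewrite orbT.
rewrite /color_of /=; case: eqP => // ew; case/negP: es.
rewrite map_cat mem_cat ew; move: ws2; rewrite inE => /orP[/eqP w0|->]; last by rewrite orbT.
by rewrite -w0 -ew mem_head in n0.
Qed.

Lemma color_root : k 0 = root_color C tab.
Proof.
rewrite /k /color_of look_notin // map_child_colors.
by case/andP: keys_uniq.
Qed.

Lemma color_child w p : (w, p) \in o -> k w = look 0 w (entry tab p (k p)).2.
Proof.
move=> wp; have [o1 [o2 oE]] : exists o1 o2, o = o1 ++ (w, p) :: o2.
  by case/splitPr: wp => o1 o2; exists o1, o2.
have kE s1 s2 v : o = s1 ++ s2 -> v \in 0 :: [seq e.1 | e <- s2] ->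
    k v = color_of (root_color C tab) (recolor tab (root_color C tab) s2) v.
  move=> oE' vo; have u := keys_uniq; rewrite /keys oE' in u.
  rewrite /k; move: (root_color _ _) => c0; move: (tab) => t; rewrite oE' color_of_cat //.
rewrite (kE o1 _ w oE); last by rewrite /= !inE eqxx orbT.
rewrite (kE (rcons o1 (w, p)) o2 p) ?cat_rcons //; last exact: parent_later oE.
by rewrite {1}/color_of /= eqxx.
Qed.

Lemma C_gt0 : 0 < C.
Proof. by apply: leq_ltn_trans (few_children (mem_head 0 _)). Qed.

Lemma root_color_min : root_color C tab < C /\
  forall c, c < C -> ((entry tab 0 (root_color C tab)).1 <= (entry tab 0 c).1)%R.
Proof.
pose l := [seq ((entry tab 0 c).1, c) | c <- down C].
have lC c : c < C -> ((entry tab 0 c).1, c) \in l.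
  by move=> cC; apply/mapP; exists c => //; rewrite mem_down.
have /mapP[c cC lE] : argmin 0 l \in l.
  by apply: argmin_mem; have := lC 0 C_gt0; case: (l).
rewrite /root_color -/l lE /=; rewrite mem_down in cC; split=> // c' /lC.
by move/(argmin_le 0); rewrite lE.
Qed.

(** The stored pair at [p] and [k p] is known to be an assignment only once [k p < C]; hence the
    induction from the root, prior to any optimality. *)
Lemma color_lt v : v \in keys -> k v < C.
Proof.
have H o1 o2 : o = o1 ++ o2 -> forall v, v \in 0 :: [seq e.1 | e <- o2] -> k v < C.
  elim: o2 o1 => [|[w p] o2 IH] o1 oE u.
    by rewrite inE => /eqP->; rewrite color_root; have [] := root_color_min.
  rewrite [map _ _]/= inE [u \in w :: _]inE orbCA => /orP[/eqP-> {u}|uo2]; last first.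
    by apply: (IH (rcons o1 (w, p))); rewrite ?cat_rcons // inE.
  have wp : (w, p) \in o by rewrite oE mem_cat mem_head orbT.
  have kp : k p < C.
    by apply: (IH (rcons o1 (w, p))); rewrite ?cat_rcons //; have := parent_later oE.
  have pk := parent_in_keys wp.
  have : p \in [seq e.1 | e <- bo] by rewrite mem_keys_bo.
  case/mapP=> -[p' q] /= pq pE; rewrite -{p'}pE in pq.
  have [/and3P[/eqP aE aC _] _ _] := entry_argmin pq kp.
  rewrite (color_child wp).
  have /mem_look : w \in [seq t.1 | t <- (entry tab p (k p)).2] by rewrite aE mem_children.
  by move=> /(_ 0) /(allP aC).
exact: (H [::]).
Qed.

Lemma color_children v : v \in keys ->
  [seq (w, k w) | w <- children o v] = (entry tab v (k v)).2.
Proof.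
move=> vk; have : v \in [seq e.1 | e <- bo] by rewrite mem_keys_bo.
case/mapP=> -[v' p] /= vp vE; rewrite -{v'}vE in vp.
have [/and3P[/eqP aE _ _] _ _] := entry_argmin vp (color_lt vk).
rewrite -[RHS](graph_look 0) aE; last exact: uniq_children.
by apply/eq_in_map => w; rewrite mem_children => /color_child ->.
Qed.

Theorem recolor_optimal :
  proper_numbering k /\ forall k', proper_numbering k' -> (coloring_cost k <= coloring_cost k')%R.
Proof.
have [kE Pk] := coloring_cost_tight color_children color_lt; split=> // k' Pk'.
rewrite kE color_root; apply: le_trans (entry_root_le Pk').
by apply: (root_color_min.2); have [] := Pk' 0 (mem_head _ _).
Qed.

(** * Polynomial size of the table entries *)

Section EntrySize.
Variables (g : K -> nat) (B : nat).
Hypothesis root_parent : n \notin keys.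
Hypothesis gD : forall x y, g (x + y)%R <= g x + g y.
Hypothesis g0 : g 0%R <= B.
Hypothesis gB : forall i j, g (tcost tb i j) <= B.
(** One [B] per triple, one for the empty sum of local costs, and one for the empty sum of the
    entries of children. *)
Let Q := (size tr).+2 * B.
Let m v := \max_(c < C) g (entry tab v c).1.

Lemma size_local_cost v a : g (local_cost tr tb v a) <= (size tr).+1 * B.
Proof.
apply: leq_trans (size_sum_le gD (B := B) _) _; last by rewrite mulSn leq_add2r.
by move=> t _; case: ifP.
Qed.

Lemma max_entry_le v : v \in keys -> m v <= Q + \sum_(w <- children o v) m w.
Proof.
move=> vk; apply/bigmax_leqP => -[c cC] _ /=.
have : v \in [seq e.1 | e <- bo] by rewrite mem_keys_bo.
case/mapP=> -[v' p] /= vp vE; rewrite -{v'}vE in vp.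
have [/and3P[/eqP aE aC _] -> _] := entry_argmin vp cC.
apply: leq_trans (gD _ _) _.
apply: leq_trans (leq_add (size_local_cost _ _) (size_sum gD _ _)) _.
rewrite addnA leq_add ?/Q //; first by rewrite [X in _ <= X]mulSn addnC leq_add2r.
rewrite -aE big_map big_seq [X in _ <= X]big_seq; apply: leq_sum => -[w i] /= wi.
by have /= iC := allP aC _ wi; apply: (leq_bigmax (Ordinal iC)).
Qed.

(** A suffix [q] of [bo] contains all descendants of its vertices, so it is a forest, and the sum
    runs over the roots of this forest. Putting [v] in front replaces its children by [v] among the
    roots, which by [max_entry_le] adds at most [Q]. Bounding the sum over roots, rather than single
    entries, prevents a growth exponential in the depth. *)
Lemma sum_max_entry q1 q : bo = q1 ++ q ->
  \sum_(e <- q | e.2 \notin [seq e.1 | e <- q]) m e.1 <= size q * Q.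
Proof.
elim: q q1 => [|[v p] q IH] q1 boE; first by rewrite big_nil.
have {}IH := IH (rcons q1 (v, p)); rewrite cat_rcons in IH; have {}IH := IH boE.
have vk : v \in keys by rewrite -mem_keys_bo boE map_cat mem_cat /= mem_head orbT.
have later : {subset children o v <= [seq e.1 | e <- q]} := children_later boE.
apply: leq_trans (_ : m v + \sum_(e <- q | e.2 \notin v :: [seq e.1 | e <- q]) m e.1 <= _).
  by rewrite big_cons /=; case: ifP => // _; apply: leq_addl.
rewrite /= mulSn; apply: leq_trans (leq_add (max_entry_le vk) (leqnn _)) _.
rewrite -addnA leq_add2l; apply: leq_trans IH.
have vq : v \notin [seq e.1 | e <- q].
  have := uniq_keys_bo; rewrite boE map_cat cat_uniq /= => /and3P[_ _ /andP[]] //.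
rewrite [X in _ <= X](bigID (fun e => e.2 == v)) /=; apply: leq_add; last first.
  by rewrite leq_eqVlt; apply/orP; left; apply/eqP; apply: eq_bigl => e; rewrite inE negb_or andbC.
have -> : \sum_(e <- q | (e.2 \notin [seq e0.1 | e0 <- q]) && (e.2 == v)) m e.1 =
    \sum_(e <- q | e.2 == v) m e.1.
  by apply: eq_bigl => e; case: eqP => [->|]; rewrite ?vq ?andbF.
rewrite -[X in _ <= X]big_filter -(big_map (fun e => e.1) xpredT m).
apply: (@uniq_sub_le_big _ _ leq leqnn (fun x y => leq_addr y x)) (uniq_children v) _ _.
  have := uniq_keys_bo; rewrite boE map_cat cat_uniq /= => /and3P[_ _ /andP[_]].
  by apply: subseq_uniq; apply: map_subseq; apply: filter_subseq.
move=> w wv; have /mapP[[w' v'] /= wq wE] := later w wv; rewrite -{w'}wE in wq.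
apply/mapP; exists (w, v') => //; rewrite mem_filter wq andbT /=.
have in_bo e : e \in o -> e \in bo by rewrite inE mem_rev => ->; rewrite orbT.
have wo : (w, v) \in bo by apply: in_bo; rewrite -mem_children.
have wbo : (w, v') \in bo by rewrite boE mem_cat inE wq !orbT.
have := uniq_keys_bo; elim: (bo) wo wbo => //= -[u p'] s IH.
rewrite !inE !xpair_eqE.
move=> /orP[/andP[/eqP<- /eqP<-]|ws] /orP[/andP[wu /eqP->]|ws'] /andP[us uniqs] //.
- by rewrite (map_f (fun e => e.1) ws') in us.
- by rewrite -(eqP wu) (map_f (fun e => e.1) ws) in us.
- exact: IH.
Qed.

(** In the suffix of [bo] that starts at [v] the parent of [v] does not occur: parents come before
    their children, and the virtual parent of the root is not a key. So [m v] is one of the summands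
    bounded by [sum_max_entry]. *)
Lemma entry_size v c : v \in keys -> c < C ->
  g (entry tab v c).1 <= (size o).+1 * Q.
Proof.
move=> vk cC; pose F (i : 'I_C) := g (entry tab v i).1.
apply: leq_trans (leq_bigmax (F := F) (Ordinal cC)) _; rewrite -/(m v).
have : v \in [seq e.1 | e <- bo] by rewrite mem_keys_bo.
case/mapP=> -[v' p] /= vp vE; rewrite -{v'}vE in vp.
have [q1 [q boE]] : exists q1 q, bo = q1 ++ (v, p) :: q.
  by case/splitPr: vp => q1 q; exists q1, q.
have le := sum_max_entry boE.
have size_q : size ((v, p) :: q) <= (size o).+1.
  have := congr1 size boE; rewrite size_cat /= size_rev; lia.
apply: leq_trans (leq_mul size_q (leqnn Q)); apply: leq_trans le.
rewrite big_cons /=; case: ifP => [_|/negbFE]; first exact: leq_addr.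
have uq := uniq_keys_bo; rewrite boE map_cat cat_uniq /= in uq.
have /and3P[_ _ /andP[vq _]] := uq.
have vpo : (v, p) \in o \/ p = n.
  by move: vp; rewrite inE mem_rev => /orP[/eqP[]|]; [right|left].
rewrite inE => /orP[/eqP pv|pq]; case: vpo => [vpo|pn].
- case/negP: vq; apply: (children_later boE); rewrite mem_children /=.
  by rewrite pv in vpo.
- by have := root_parent; rewrite -pn pv vk.
- case/mapP: pq => -[p' p2] /= pq pE; rewrite -{p'}pE in pq.
  case/splitPr: pq boE vq => [q2 q3] boE vq.
  have boE' : bo = (q1 ++ (v, p) :: q2) ++ (p, p2) :: q3 by rewrite boE -catA.
  case/negP: vq; rewrite map_cat mem_cat inE; apply/orP; right; apply/orP; right.
  by apply: (children_later boE'); rewrite mem_children.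
- move/negP: root_parent; case; rewrite -pn -mem_keys_bo boE map_cat mem_cat inE pq.
  by rewrite !orbT.
Qed.

End EntrySize.

End Optimality.

(** * Rooting a tree by graph search *)

Definition vertices (o : seq (nat * nat)) : seq nat := 0 :: [seq e.1 | e <- o].

Definition frontier (arcs o : seq (nat * nat)) : seq (nat * nat) :=
  [seq e <- arcs | (e.1 \in vertices o) && (e.2 \notin vertices o)].

(** The new vertex goes in front of the list, hence before its parent, as an order requires. *)
Definition grow (arcs o : seq (nat * nat)) : seq (nat * nat) :=
  if nilp (frontier arcs o) then o else
  ((head (0, 0) (frontier arcs o)).2, (head (0, 0) (frontier arcs o)).1) :: o.

Definition search_order (n : nat) (arcs : seq (nat * nat)) : seq (nat * nat) :=
  iter n (grow arcs) [::].

Lemma vertices_cons e o x : (x \in vertices (e :: o)) = (x == e.1) || (x \in vertices o).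
Proof. by rewrite !inE /= orbCA. Qed.

Section SearchOrder.
Variables (n : nat) (arcs : seq (nat * nat)).
Hypothesis n_gt0 : 0 < n.
Hypothesis arcs_lt : forall u v, (u, v) \in arcs -> u < n /\ v < n.

Fixpoint grown (o : seq (nat * nat)) : Prop :=
  if o is e :: o' then
    [/\ e.1 \notin vertices o', e.2 \in vertices o', (e.2, e.1) \in arcs & grown o']
  else True.

Lemma grown_grow o : grown o -> grown (grow arcs o).
Proof.
rewrite /grow; case fE : (frontier arcs o) => [|[u v] f] //= go.
have : (u, v) \in frontier arcs o by rewrite fE mem_head.
by rewrite mem_filter => /andP[/andP[]].
Qed.

Lemma grown_uniq o : grown o -> uniq (vertices o).
Proof.
elim: o => //= e o IH [eo _ _ /IH /andP[o0 uo]]; move: eo.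
rewrite inE negb_or => /andP[e0 eo].
by rewrite inE negb_or eq_sym e0 o0 eo uo.
Qed.

Lemma grown_lt o : grown o -> {in vertices o, forall v, v < n}.
Proof.
elim: o => [_ v|e o IH [_ _ /arcs_lt[_ en] go] v]; first by rewrite inE => /eqP->.
rewrite /= !inE orbCA => /orP[/eqP->//|vo]; exact: IH.
Qed.

Lemma grown_size o : grown o -> size o < n.
Proof.
move=> go; rewrite -(size_map (fun e => e.1)) -[_.+1]/(size (vertices o)) -[n]size_down.
apply: uniq_leq_size; first exact: grown_uniq.
by move=> v /(grown_lt go); rewrite mem_down.
Qed.

Lemma grown_parents o o1 e o2 : grown o -> o = o1 ++ e :: o2 ->
  e.2 \in vertices o2.
Proof.
elim: o1 o => [|e1 o1 IH] o go oE; rewrite oE in go; first by case: go.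
by case: go => _ _ _ /IH; apply.
Qed.

Lemma grown_arcs o : grown o -> forall w p, (w, p) \in o -> (p, w) \in arcs.
Proof.
elim: o => //= -[w p] o IH [_ _ pw /IH H] w' p'.
by rewrite inE => /orP[/eqP[-> ->]|/H].
Qed.

Lemma grown_parent_mem o w p : grown o -> (w, p) \in o -> p \in vertices o.
Proof.
elim: o => //= e o IH [_ po _ go]; rewrite inE vertices_cons.
by case/orP=> [/eqP eE|/(IH go) ->]; [rewrite -eE /= in po; rewrite po orbT|rewrite orbT].
Qed.

Lemma grown_antisym o w p : grown o -> (w, p) \in o -> (p, w) \notin o.
Proof.
elim: o => // -[w' p'] o IH /= [wo po _ go].
rewrite !inE !xpair_eqE => /orP[/andP[/eqP-> /eqP->]|wp].
  apply/negP=> /orP[/andP[/eqP pw _]|/(grown_parent_mem go) w'o].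
    by rewrite -pw po in wo.
  by rewrite w'o in wo.
rewrite negb_or (IH go wp) andbT; apply: contra wo => /andP[/eqP<- _].
exact: grown_parent_mem wp.
Qed.

Lemma grown_search : grown (search_order n arcs).
Proof. by rewrite /search_order; elim: n => //= i; apply: grown_grow. Qed.

(** Each round adds a pair unless the frontier is empty, and a grown list has fewer than [n] pairs;
    so [n] rounds cannot all have added one. *)
Lemma frontier_search : frontier arcs (search_order n arcs) = [::].
Proof.
have H i : size (iter i (grow arcs) [::]) = i \/
    frontier arcs (iter i (grow arcs) [::]) = [::].
  elim: i => [|i IH] /=; first by left.
  set o' := iter i _ _ in IH *; rewrite /grow.
  case fE : (frontier arcs o') => [|e f] /=; first by right; rewrite /= fE.
  by left; case: IH => [->|] //; rewrite fE.
have [sz|//] := H n.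
by have := grown_size grown_search; rewrite sz ltnn.
Qed.

Hypothesis arcs_conn : forall S : {pred nat}, 0 \in S ->
  (forall u v, u \in S -> (u, v) \in arcs -> v \in S) -> forall v, v < n -> v \in S.
Hypothesis arcs_sym : forall u v, (u, v) \in arcs -> (v, u) \in arcs.
Hypothesis arcs_irr : forall u, (u, u) \notin arcs.
Let adjn : rel nat := fun u v => (u, v) \in arcs.
Hypothesis arcs_acyclic : forall c : seq nat, 2 < size c -> ~ ucycle adjn c.

(** With an empty frontier the reached vertices are closed under arcs, so connectivity makes them
    all vertices. *)
Lemma search_complete v : (v \in vertices (search_order n arcs)) = (v < n).
Proof.
apply/idP/idP; first exact: (grown_lt grown_search).
move: v; apply: arcs_conn => [|u v uS uv]; first exact: mem_head.
apply: contraT => vS; have : (u, v) \in frontier arcs (search_order n arcs).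
  by rewrite mem_filter uS vS uv.
by rewrite frontier_search.
Qed.

Lemma grown_path o : grown o -> {in vertices o &, forall x y,
  exists s, [/\ path adjn x s, last x s = y & {subset s <= vertices o}]}.
Proof.
elim: o => [_ x y|[w p] o IH /= [wo po pw /IH {}IH] x y].
  by rewrite !inE => /eqP-> /eqP->; exists [::].
have sub : {subset vertices o <= vertices ((w, p) :: o)}.
  by move=> v; rewrite vertices_cons orbC => ->.
have wv : w \in vertices ((w, p) :: o) by rewrite vertices_cons eqxx.
rewrite !vertices_cons /=.
case/orP=> [/eqP->|xo] /orP[/eqP->|yo].
- by exists [::].
- have [s [ps ls ss]] := IH p y po yo; exists (p :: s); split=> //=.
    by rewrite ps andbT; apply: arcs_sym.
  by move=> v; rewrite inE => /orP[/eqP->|/ss]; apply: sub.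
- have [s [ps ls ss]] := IH x p xo po; exists (rcons s w); split.
  + by rewrite rcons_path ps ls.
  + by rewrite last_rcons.
  + by move=> v; rewrite mem_rcons inE => /orP[/eqP->|/ss /sub].
- have [s [ps ls ss]] := IH x y xo yo; exists s; split=> // v /ss; exact: sub.
Qed.

(* A second arc from a new vertex back into the grown part would close a cycle. *)
Lemma grown_edges o : grown o -> {in vertices o &, forall u v,
  (u, v) \in arcs -> (u, v) \in o \/ (v, u) \in o}.
Proof.
have new w p o' : grown ((w, p) :: o') -> forall v, v \in vertices o' ->
    (w, v) \in arcs -> v = p.
  case=> /= wo po pw go v vo wv; apply/eqP; apply: contraT => vp.
  have [s [ps ls ss]] := grown_path go po vo.
  case/shortenP: ps ls => s' ps' us' sub ls'.
  exfalso; apply: (@arcs_acyclic (w :: p :: s')).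
    by case: s' ls' {ps' us' sub} => //= vE; rewrite vE eqxx in vp.
  apply/andP; split.
    by rewrite /= rcons_path ps' ls' /adjn (arcs_sym pw) (arcs_sym wv).
  rewrite cons_uniq us' andbT.
  apply: contra wo; rewrite inE => /orP[/eqP->//|/sub /ss //].
elim: o => [_ u v|[w p] o IH go u v].
  by rewrite !inE => /eqP-> /eqP->; rewrite (negPf (arcs_irr 0)).
have [/= _ _ _ /IH {}IH] := go.
rewrite !vertices_cons /=.
case/orP=> [/eqP->|uo] /orP[/eqP->|vo] uv.
- by rewrite (negPf (arcs_irr w)) in uv.
- by left; rewrite (new _ _ _ go _ vo uv) mem_head.
- by right; rewrite (new _ _ _ go _ uo (arcs_sym uv)) mem_head.
- by case: (IH u v uo vo uv) => H; [left|right]; rewrite inE H orbT.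
Qed.

Lemma search_edges u v : (u, v) \in arcs ->
  (u, v) \in search_order n arcs \/ (v, u) \in search_order n arcs.
Proof.
move=> uv; have [un vn] := arcs_lt uv.
by apply: (grown_edges grown_search); rewrite ?search_complete.
Qed.

End SearchOrder.

(** * Correctness of the algorithm on instances *)

Definition path_arcs (ps : seq (seq nat)) : seq (nat * nat) :=
  flatten [seq pairs P | P <- ps] ++
  [seq (e.2, e.1) | e <- flatten [seq pairs P | P <- ps]].

(** [cc] selects the changeover cost, where a traversal shared by several paths counts once;
    otherwise multiplicities are kept, as in the reload cost. *)
Definition path_triples (cc : bool) (ps : seq (seq nat)) : seq (nat * (nat * nat)) :=
  let tr := flatten [seq triples P | P <- ps] in if cc then undup tr else tr.

Definition solver (K : realDomainType) (cc : bool) (n C : nat) (ps : seq (seq nat))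
    (tb : seq (seq K)) : seq (nat * nat * nat) :=
  let o := search_order n (path_arcs ps) in
  let tab := table C (path_triples cc ps) tb o ((0, n) :: rev o) in
  recolor tab (root_color C tab) o.

Lemma pairs_map (T U : Type) (f : T -> U) (s : seq T) :
  pairs (map f s) = [seq (f e.1, f e.2) | e <- pairs s].
Proof. by elim: s => // a [|b s] //= IH; congr cons; apply: IH. Qed.

Lemma triples_map (T U : Type) (f : T -> U) (s : seq T) :
  triples (map f s) = [seq (f e.1, (f e.2.1, f e.2.2)) | e <- triples s].
Proof. by elim: s => // a [|b [|c s]] //= IH; congr cons; apply: IH. Qed.

Lemma pairs_pairs (T : Type) (s : seq T) :
  pairs (pairs s) = [seq ((t.1, t.2.1), (t.2.1, t.2.2)) | t <- triples s].
Proof. by elim: s => // a [|b [|c s]] //= IH; congr cons; apply: IH. Qed.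

Lemma mem_pairs (T : eqType) (s : seq T) e : uniq s -> e \in pairs s -> e.1 != e.2.
Proof.
elim: s => // a [|b s] // IH /andP[ab us].
rewrite /pairs /= -[zip _ _]/(pairs (b :: s)) inE => /orP[/eqP->|/(IH us) //] /=.
by move: ab; rewrite inE negb_or => /andP[].
Qed.

Lemma mem_triples (T : eqType) (s : seq T) t : uniq s -> t \in triples s ->
  [/\ (t.1, t.2.1) \in pairs s, (t.2.1, t.2.2) \in pairs s & t.1 != t.2.2].
Proof.
elim: s => // a [|b [|c s]] // IH /andP[ab us].
rewrite /triples /= -[zip _ _]/(triples [:: b, c & s]) inE => /orP[/eqP->|/(IH us)] /=.
  split; rewrite ?inE ?eqxx ?orbT //.
  by move: ab; rewrite !inE !negb_or => /and3P[].
by case=> H1 H2 H3; split=> //; rewrite -[pairs _]/((a, b) :: pairs [:: b, c & s]) inE ?H1 ?H2 orbT.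
Qed.

(** Injectivity is asked on [s] only: a triple of vertices is recovered from its two edges, as
    unordered sets, when its vertices are distinct, but not in general. *)
Lemma undup_map_in (T U : eqType) (f : T -> U) (s : seq T) :
  {in s &, injective f} -> undup (map f s) = map f (undup s).
Proof.
elim: s => //= a s IH inj; rewrite IH; last first.
  by move=> x y xs ys; apply: inj; rewrite inE ?xs ?ys orbT.
rewrite (_ : (f a \in map f s) = (a \in s)); first by case: ifP.
apply/mapP/idP => [[x xs fE]|]; last by exists a.
by rewrite (inj a x) ?mem_head // inE xs orbT.
Qed.

Lemma set2_eq (T : finType) (a b c d : T) : [set a; b] = [set c; d] ->
  (a = c /\ b = d) \/ (a = d /\ b = c).
Proof.
move=> E; have := set21 a b; have := set22 a b; rewrite E !inE.
have := set21 c d; have := set22 c d; rewrite -E !inE.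
do 4!case/orP=> /eqP ?; subst; auto.
Qed.

Lemma sum_mem_set (T : finType) (V : nmodType) (s : seq T) (F : T -> V) :
  (\sum_(t in [set t in s]) F t = \sum_(t <- undup s) F t)%R.
Proof.
rewrite -big_enum; apply: perm_big; apply: uniq_perm; rewrite ?enum_uniq ?undup_uniq //.
by move=> t; rewrite mem_enum inE mem_undup.
Qed.

(** * Grouping traversals by their middle vertex *)

Section CostByCenter.
Variables (K : realDomainType) (n : nat) (tr : seq (nat * (nat * nat))).
Variables (tb : seq (seq K)) (arcs : seq (nat * nat)).
Let o := search_order n arcs.
Hypothesis arcs_lt : forall u v, (u, v) \in arcs -> u < n /\ v < n.
Hypothesis arcs_sym : forall u v, (u, v) \in arcs -> (v, u) \in arcs.
Hypothesis o_complete : forall v, (v \in vertices o) = (v < n).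
Hypothesis o_edges : forall u v, (u, v) \in arcs -> (u, v) \in o \/ (v, u) \in o.
Variables (f : nat -> nat -> nat) (k : nat -> nat).
Hypothesis f_child : forall w p, (w, p) \in o -> f w p = k w.
Hypothesis f_sym : forall u v, f u v = f v u.

Let grown_o : grown arcs o := grown_search n arcs.

Lemma keys_uniq : uniq (0 :: [seq e.1 | e <- o]).
Proof. exact: (grown_uniq grown_o). Qed.

Lemma parent_unique w p p' : (w, p) \in o -> (w, p') \in o -> p = p'.
Proof.
have := keys_uniq; rewrite /= => /andP[_]; elim: (o) => //= -[u q] s IH.
rewrite !inE !xpair_eqE => /andP[us uniqs].
move=> /orP[/andP[/eqP wu /eqP->]|ws] /orP[/andP[/eqP wu' /eqP->]|ws'] //.
- by move/(map_f (fun e => e.1)): ws'; rewrite /= wu (negPf us).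
- by move/(map_f (fun e => e.1)): ws; rewrite /= wu' (negPf us).
- exact: IH.
Qed.

Lemma look_color v p a : (v, p) \in (0, n) :: rev o -> (a, v) \in arcs ->
  look 0 a ((p, k v) :: [seq (w, k w) | w <- children o v]) = f a v.
Proof.
rewrite inE mem_rev look_cons /= => vp av; case: eqP => [pa|pa].
  (* At the root the parent is the virtual [n], which is not the end of any arc. *)
  case/orP: vp => [/eqP[_ pn]|vp]; last by rewrite f_sym f_child // -pa.
  by have [] := arcs_lt av; rewrite -pa pn ltnn.
have av' : (a, v) \in o.
  case: (o_edges av) => // va; case/orP: vp => [/eqP[v0 _]|vp].
    have := keys_uniq; move/(map_f (fun e => e.1)): va => /= va.
    by rewrite -v0 va.
  by case: pa; apply: parent_unique va.
by rewrite look_graph ?f_child // mem_children.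
Qed.

Hypothesis tr_arcs : forall t, t \in tr ->
  (t.1, t.2.1) \in arcs /\ (t.2.1, t.2.2) \in arcs.

(** Every traversal is charged to its middle vertex, which is a key exactly once. Both of its edges
    are incident there, so both colors can be read from the assignment at that vertex. *)
Lemma cost_by_center : (\sum_(t <- tr) tcost tb (f t.1 t.2.1) (f t.2.1 t.2.2) =
  coloring_cost n tr tb o k)%R.
Proof.
rewrite /coloring_cost /local_cost exchange_big big_seq [RHS]big_seq /=.
apply: eq_bigr => t /tr_arcs [av vd]; set v := t.2.1 in av vd *; set x := tcost _ _ _.
have vk : v \in [seq e.1 | e <- (0, n) :: rev o].
  by rewrite mem_keys_bo -/(vertices o) o_complete; have [] := arcs_lt av.
rewrite -[LHS](sum_if_eq x vk (uniq_keys_bo n keys_uniq)) big_map.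
apply: eq_big_seq => -[v' p] vp; rewrite -[(v', p).1]/v' -[(v', p).2]/p eq_sym.
case: eqP => // vE; rewrite -{v' }vE in vp *.
have /= -> := look_color vp av; have /= -> := look_color vp (arcs_sym vd).
by rewrite /x [f v t.2.2]f_sym.
Qed.

End CostByCenter.

(** * Translation between instances and plain numbers *)

Section InstanceData.
Variables (K : realDomainType) (I : instance K).

(** The type of vertices depends on the instance, whereas a context needs one type of data for all
    instances; hence plain numbers. *)
Definition nat_paths : seq (seq nat) := [seq [seq nat_of_ord v | v <- P] | P <- paths I].

Definition cost_table : seq (seq K) :=
  [seq [seq tc i j | j <- enum (color I)] | i <- enum (color I)].

Lemma tcost_table (i j : color I) : tcost cost_table i j = tc i j.
Proof.
rewrite /tcost (nth_map i) ?size_enum_ord // (nth_map i) ?size_enum_ord //.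
by rewrite !nth_ord_enum.
Qed.

Definition ord_arcs : seq (vertex I * vertex I) := flatten [seq pairs P | P <- paths I].
Definition ord_triples : seq (vertex I * (vertex I * vertex I)) :=
  flatten [seq triples P | P <- paths I].

Lemma nat_arcsE : flatten [seq pairs P | P <- nat_paths] =
  [seq (nat_of_ord e.1, nat_of_ord e.2) | e <- ord_arcs].
Proof.
rewrite /ord_arcs map_flatten -!map_comp; congr flatten; apply: eq_map => P /=.
exact: pairs_map.
Qed.

Lemma nat_triplesE cc : path_triples cc nat_paths =
  [seq (nat_of_ord t.1, (nat_of_ord t.2.1, nat_of_ord t.2.2))
     | t <- if cc then undup ord_triples else ord_triples].
Proof.
have E : flatten [seq triples P | P <- nat_paths] =
    [seq (nat_of_ord t.1, (nat_of_ord t.2.1, nat_of_ord t.2.2)) | t <- ord_triples].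
  rewrite /ord_triples map_flatten -!map_comp; congr flatten; apply: eq_map => P /=.
  exact: triples_map.
rewrite /path_triples E; case: cc => //; apply: undup_map_inj.
by move=> [a [b c]] [a' [b' c']] /= [/val_inj-> /val_inj-> /val_inj->].
Qed.

Lemma mem_edges e : (e \in edges I) = (e \in [seq [set x.1; x.2] | x <- ord_arcs]).
Proof. by rewrite inE /ord_arcs map_flatten -map_comp. Qed.

Lemma adj_arcs (u v : vertex I) :
  adj u v = ((nat_of_ord u, nat_of_ord v) \in path_arcs nat_paths).
Proof.
rewrite /adj mem_edges /path_arcs nat_arcsE mem_cat -map_comp; apply/mapP/orP.
  case=> -[x y] xy /set2_eq[[-> ->]|[-> ->]]; [left|right]; apply/mapP;
  by exists (x, y).
case=> /mapP[[x y] xy /= [/val_inj-> /val_inj->]]; exists (x, y) => //.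
exact: setUC.
Qed.

Lemma arcs_ord a b : (a, b) \in path_arcs nat_paths ->
  exists u v : vertex I, [/\ a = u, b = v & adj u v].
Proof.
move=> ab; have : exists u v : vertex I, a = u /\ b = v.
  move: ab; rewrite /path_arcs nat_arcsE mem_cat -map_comp.
  by case/orP=> /mapP[[x y] _ /= [-> ->]]; [exists x, y|exists y, x].
by case=> u [v [au bv]]; exists u, v; rewrite adj_arcs -au -bv.
Qed.

Lemma arcs_sym a b : (a, b) \in path_arcs nat_paths -> (b, a) \in path_arcs nat_paths.
Proof. by case/arcs_ord=> u [v [-> ->]]; rewrite -adj_arcs /adj setUC. Qed.

Lemma arcs_lt a b : (a, b) \in path_arcs nat_paths -> a < nvert I /\ b < nvert I.
Proof. by case/arcs_ord=> u [v [-> -> _]]. Qed.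

Lemma ord_seq (s : seq nat) : {in s, forall a, a < nvert I} ->
  exists s' : seq (vertex I), s = [seq nat_of_ord v | v <- s'].
Proof.
elim: s => [|a s IH] sn; first by exists [::].
have [|s' ->] := IH; first by move=> b bs; apply: sn; rewrite inE bs orbT.
by exists (Ordinal (sn a (mem_head _ _)) :: s').
Qed.

Hypotheses (valid : valid_instance I) (tree : is_tree I).

Lemma path_uniq P : P \in paths I -> uniq P.
Proof. by case: valid => _ H _ _ _ /H[]. Qed.

Lemma ord_arcs_neq x : x \in ord_arcs -> x.1 != x.2.
Proof. by case/flattenP=> s /mapP[P /path_uniq uP ->]; apply: mem_pairs. Qed.

Lemma arcs_irr a : (a, a) \notin path_arcs nat_paths.
Proof.
apply/negP; rewrite /path_arcs nat_arcsE mem_cat -map_comp.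
by case/orP=> /mapP[[x y] /ord_arcs_neq /= xy [-> /val_inj E]]; rewrite E eqxx in xy.
Qed.

Lemma nvert_gt0 : 0 < nvert I. Proof. by case: tree. Qed.

Lemma arcs_conn (S : {pred nat}) : 0 \in S ->
  (forall u v, u \in S -> (u, v) \in path_arcs nat_paths -> v \in S) ->
  forall v, v < nvert I -> v \in S.
Proof.
move=> S0 Scl v vn; case: tree => _ conn _.
have /connectP[s ps vE] : connect (@adj K I) (Ordinal nvert_gt0) (Ordinal vn) by [].
have -> : v = nat_of_ord (last (Ordinal nvert_gt0) s) by rewrite -vE.
have cl (u : vertex I) : (u : nat) \in S -> path (@adj K I) u s -> (last u s : nat) \in S.
  elim: s {ps vE} u => //= w s IH u uS /andP[uw]; apply: IH.
  by apply: Scl uS _; rewrite -adj_arcs.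
exact: cl ps.
Qed.

Lemma arcs_acyclic c : 2 < size c ->
  ~ ucycle (fun u v => (u, v) \in path_arcs nat_paths) c.
Proof.
move=> c2 cy; have [c' cE] : exists c' : seq (vertex I), c = [seq nat_of_ord v | v <- c'].
  apply: ord_seq => a ac; case/andP: cy => cy _.
  by have /arcs_lt[] := next_cycle cy ac.
case: tree => _ _ /(_ c'); apply; first by rewrite cE size_map in c2.
move: cy; rewrite cE /ucycle cycle_map (map_inj_uniq val_inj) => /andP[cy ->].
by rewrite andbT; move: cy; rewrite (eq_cycle (e' := @adj K I)) // => u v /=; rewrite adj_arcs.
Qed.

Let n := nvert I.
Let C := ncol I.
Let arcs := path_arcs nat_paths.
Definition inst_order := search_order (nvert I) (path_arcs nat_paths).
Local Notation o := inst_order.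

Lemma order_grown : grown arcs o. Proof. exact: grown_search. Qed.

Lemma order_complete v : (v \in vertices o) = (v < n).
Proof. exact: (search_complete nvert_gt0 (@arcs_lt) arcs_conn). Qed.

Lemma order_edges u v : (u, v) \in arcs -> (u, v) \in o \/ (v, u) \in o.
Proof.
apply: (search_edges nvert_gt0 (@arcs_lt) arcs_conn (@arcs_sym) arcs_irr arcs_acyclic).
Qed.

Lemma order_uniq : uniq (0 :: [seq e.1 | e <- o]).
Proof. exact: (grown_uniq order_grown). Qed.

Lemma order_parents o1 e o2 : o = o1 ++ e :: o2 -> e.2 \in 0 :: [seq e.1 | e <- o2].
Proof. exact: (grown_parents order_grown). Qed.

Lemma root_parent : n \notin 0 :: [seq e.1 | e <- o].
Proof. by rewrite -/(vertices o) order_complete ltnn. Qed.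

Lemma order_arcs w p : (w, p) \in o -> (w, p) \in arcs.
Proof. by move/(grown_arcs order_grown)/arcs_sym. Qed.

Lemma order_size : size o < n. Proof. exact: (grown_size nvert_gt0 (@arcs_lt) order_grown). Qed.

Lemma size_children_degree v : v \in 0 :: [seq e.1 | e <- o] ->
  size (children o v) <= max_degree I.
Proof.
rewrite -/(vertices o) order_complete => vn; pose u : vertex I := Ordinal vn.
apply: leq_trans (leq_bigmax (F := fun v => #|[set w | adj v w]|) u).
rewrite cardE -(size_map (@nat_of_ord _)); apply: uniq_leq_size.
  exact: uniq_children order_uniq _.
move=> w; rewrite mem_children => /order_arcs wv; apply/mapP.
have [wn _] := arcs_lt wv; exists (Ordinal wn) => //.
by rewrite mem_enum inE adj_arcs; apply: arcs_sym.
Qed.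

Lemma few_children v : v \in 0 :: [seq e.1 | e <- o] -> size (children o v) < C.
Proof.
move/size_children_degree => le; case: valid => _ _ _ dC _.
by apply: leq_trans dC; rewrite addn1.
Qed.

Lemma ncol_gt0 : 0 < C.
Proof. exact: leq_ltn_trans (few_children (mem_head _ _)). Qed.

Definition to_vertex (a : nat) : vertex I := insubd (Ordinal nvert_gt0) a.
Definition to_color (c : nat) : color I := insubd (Ordinal ncol_gt0) c.

Lemma to_vertexK (v : vertex I) : to_vertex v = v.
Proof. exact: valKd. Qed.

Lemma to_colorK c : c < C -> to_color c = c :> nat.
Proof. by move=> cC; rewrite /to_color insubdK. Qed.

Lemma to_vertex_val a : a < n -> to_vertex a = a :> nat.
Proof. by move=> an; rewrite /to_vertex insubdK. Qed.

Definition edge (a b : nat) : {set vertex I} := [set to_vertex a; to_vertex b].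

Lemma edgeC a b : edge a b = edge b a. Proof. exact: setUC. Qed.

Lemma edge_inj a b c d : a < n -> b < n -> c < n -> d < n -> edge a b = edge c d ->
  (a = c /\ b = d) \/ (a = d /\ b = c).
Proof.
have inj x y : x < n -> y < n -> to_vertex x = to_vertex y -> x = y.
  by move=> xn yn /(congr1 val) /=; rewrite !to_vertex_val.
move=> an bn cn dn /set2_eq[[/(inj _ _ an cn)-> /(inj _ _ bn dn)->]|]; first by left.
by case=> /(inj _ _ an dn)-> /(inj _ _ bn cn)->; right.
Qed.

(** Acyclicity enters through [order_edges]: the search order, a spanning tree, misses no edge. *)
Lemma edgesP e : reflect (exists a b, (a, b) \in o /\ e = edge a b) (e \in edges I).
Proof.
apply: (iffP idP) => [|[a [b [ab ->]]]]; last first.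
  by have /arcs_ord[u [v [-> -> uv]]] := order_arcs ab; rewrite /edge !to_vertexK.
rewrite mem_edges => eI; have [x [y [eE xy]]] : exists x y : vertex I, e = [set x; y] /\ adj x y.
  by case/mapP: (eI) => -[x y] _ eE; exists x, y; rewrite /adj mem_edges -eE.
move: xy; rewrite adj_arcs => /order_edges[] H;
  [exists (x : nat), (y : nat)|exists (y : nat), (x : nat)]; split=> //;
by rewrite /edge !to_vertexK // setUC.
Qed.

Definition nat_coloring (chi : coloring I) (a b : nat) : nat := chi (edge a b).

Lemma nat_coloringC chi a b : nat_coloring chi a b = nat_coloring chi b a.
Proof. by rewrite /nat_coloring edgeC. Qed.

Lemma traversalsE (P : seq (vertex I)) : traversals P =
  [seq ([set t.1; t.2.1], [set t.2.1; t.2.2]) | t <- triples P].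
Proof.
rewrite /traversals -[zip _ _]/(pairs (map (fun e => [set e.1; e.2]) (pairs P))).
by rewrite pairs_map pairs_pairs -map_comp.
Qed.

Definition path_cost (cc : bool) : coloring I -> K :=
  if cc then @changeover_cost K I else @reload_cost K I.

Lemma path_costE cc chi : path_cost cc chi =
  (\sum_(t <- path_triples cc nat_paths) tcost cost_table
     (nat_coloring chi t.1 t.2.1) (nat_coloring chi t.2.1 t.2.2))%R.
Proof.
pose h (t : vertex I * (vertex I * vertex I)) := ([set t.1; t.2.1], [set t.2.1; t.2.2]).
have E s : (\sum_(t <- [seq (nat_of_ord t.1, (nat_of_ord t.2.1, nat_of_ord t.2.2)) | t <- s])
     tcost cost_table (nat_coloring chi t.1 t.2.1) (nat_coloring chi t.2.1 t.2.2) =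
   \sum_(t <- map h s) traversal_cost chi t)%R.
  rewrite !big_map; apply: eq_bigr => -[a [b c]] _ /=.
  by rewrite /nat_coloring /edge !to_vertexK tcost_table.
have trE : flatten [seq traversals P | P <- paths I] = map h ord_triples.
  rewrite /ord_triples map_flatten -map_comp; congr flatten.
  by apply: eq_map => P; apply: traversalsE.
rewrite nat_triplesE E; case: cc; rewrite /path_cost; last first.
  by rewrite /reload_cost -trE big_flatten big_map.
rewrite /changeover_cost /all_traversals sum_mem_set trE undup_map_in //.
(* A traversal determines its triple, because the three vertices are distinct on a path; this
   excludes reading either edge backwards. *)
move=> [a [b c]] [a' [b' c']] /flattenP[s /mapP[P PI ->] tP] /flattenP[s' /mapP[P' P'I ->] tP'].
have [/(mem_pairs (path_uniq PI)) /= ab _ ac] := mem_triples (path_uniq PI) tP.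
have [/(mem_pairs (path_uniq P'I)) /= ab' _ ac'] := mem_triples (path_uniq P'I) tP'.
rewrite /h /= => -[/set2_eq E1 /set2_eq E2].
case: E1 => [[aE bE]|[aE bE]]; case: E2 => [[bE' cE]|[bE' cE]]; subst=> //.
all: by rewrite ?eqxx in ab ab' ac ac'.
Qed.

Lemma edge_arc a b : (a, b) \in arcs -> edge a b \in edges I.
Proof. by case/arcs_ord=> u [v [-> -> uv]]; rewrite /edge !to_vertexK. Qed.

Lemma proper_arcs chi a b v : proper_coloring chi -> (a, v) \in arcs ->
  (b, v) \in arcs -> a != b -> nat_coloring chi a v != nat_coloring chi b v.
Proof.
move=> Pchi av bv ab; have [an vn] := arcs_lt av; have [bn _] := arcs_lt bv.
apply: (contra_neq (@val_inj _ _ _ _ _)); apply: Pchi; rewrite ?edge_arc //.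
  apply: contra_neq ab => /(edge_inj an vn bn vn) [[]|[-> ->]] //.
by apply/set0Pn; exists (to_vertex v); rewrite !inE eqxx !orbT.
Qed.

Lemma path_cost_numbering cc chi k :
  (forall w p, (w, p) \in o -> nat_coloring chi w p = k w) ->
  path_cost cc chi = coloring_cost n (path_triples cc nat_paths) cost_table o k.
Proof.
move=> kE; rewrite path_costE; apply: cost_by_center => //.
- exact: arcs_lt.
- exact: arcs_sym.
- exact: order_complete.
- exact: order_edges.
- exact: nat_coloringC.
move=> t tt; have : t \in path_triples false nat_paths.
  by move: tt; rewrite /path_triples; case: (cc); rewrite ?mem_undup.
rewrite nat_triplesE => /mapP[[a [b d]] /flattenP[s /mapP[P PI ->] tP] ->] /=.
have [ab bd _] := mem_triples (path_uniq PI) tP.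
rewrite -!adj_arcs /adj !mem_edges; split; apply/mapP.
  by exists (a, b) => //; apply/flattenP; exists (pairs P) => //; apply: map_f.
by exists (b, d) => //; apply/flattenP; exists (pairs P) => //; apply: map_f.
Qed.

(* The root gets the color of a virtual edge to a parent: since there are more
   colors than neighbors, some color is free at the root. *)
Lemma numbering_of_coloring chi : proper_coloring chi -> exists2 k,
  proper_numbering C o k & forall w p, (w, p) \in o -> nat_coloring chi w p = k w.
Proof.
move=> Pchi.
have [c cC cN] : exists2 c, c < C & c \notin [seq nat_coloring chi w 0 | w <- children o 0].
  have : has (fun c => c \notin [seq nat_coloring chi w 0 | w <- children o 0]) (down C).
    apply: contraT => /hasPn sub.
    have := uniq_leq_size (uniq_down C) (fun c cd => negbNE (sub c cd)).
    by rewrite size_down size_map leqNgt few_children // mem_head.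
  by case/hasP=> c; rewrite mem_down => cC cN; exists c.
pose k w := if w == 0 then c else nat_coloring chi w (look 0 w o).
have kE w p : (w, p) \in o -> nat_coloring chi w p = k w.
  move=> wp; rewrite /k; case: eqP => [w0|_].
    have := order_uniq; move/(map_f (fun e => e.1)): wp => /= wp.
    by rewrite -w0 wp.
  congr nat_coloring; apply: (parent_unique wp); apply: mem_look.
  exact: (map_f (fun e => e.1) wp).
exists k => // v vk; split.
  by rewrite /k; case: ifP => // _; apply: ltn_ord.
have -> : [seq k w | w <- children o v] = [seq nat_coloring chi w v | w <- children o v].
  by apply/eq_in_map => w; rewrite mem_children => /kE.
rewrite /= map_inj_in_uniq ?(uniq_children order_uniq) ?andbT; last first.
  move=> w w'; rewrite !mem_children => /order_arcs wv /order_arcs wv' /eqP E.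
  by apply/eqP; apply: contraT => /(proper_arcs Pchi wv wv'); rewrite E.
have := vk; rewrite inE => /orP[/eqP v0|/mapP[[v' p] /= vp vE]].
  by rewrite v0 /k eqxx.
rewrite -{v'}vE in vp; rewrite -(kE _ _ vp) nat_coloringC.
apply/mapP=> -[w]; rewrite mem_children => wv /eqP; apply/negP.
apply: proper_arcs => //; [|exact: order_arcs|].
  exact/arcs_sym/order_arcs.
by apply: contraTneq wv => <-; apply: grown_antisym vp; apply: order_grown.
Qed.

(** An edge gets the color of its lower end, found through the pair of [o] representing it. The
    default [(0, 0)] is reached only on sets that are not edges. *)
Definition coloring_of (k : nat -> nat) : coloring I := fun e =>
  to_color (k (head (0, 0) [seq x <- o | edge x.1 x.2 == e]).1).

Section ColoringOf.
Variable k : nat -> nat.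
Hypothesis kP : proper_numbering C o k.

Lemma numbering_lt w p : (w, p) \in o -> k w < C.
Proof.
by move/(map_f (fun e => e.1)) => wo; have [] := kP (v := w) _; rewrite ?inE ?wo ?orbT.
Qed.

Lemma order_lt w p : (w, p) \in o -> w < n /\ p < n.
Proof. by move/order_arcs/arcs_lt. Qed.

(** Two pairs of [o] with the same underlying edge are equal or reversed, and [grown_antisym]
    excludes the latter. *)
Lemma coloring_ofE w p : (w, p) \in o -> coloring_of k (edge w p) = to_color (k w).
Proof.
move=> wp; rewrite /coloring_of; set s := filter _ _.
have : (w, p) \in s by rewrite mem_filter eqxx.
have : forall x, x \in s -> x = (w, p).
  move=> [w' p']; rewrite mem_filter => /andP[/eqP E wp'].
  have [wn pn] := order_lt wp; have [wn' pn'] := order_lt wp'.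
  case: (edge_inj wn' pn' wn pn E) => [[-> ->]|[w'p p'w]] //.
  by have := grown_antisym order_grown wp; rewrite -w'p -p'w wp'.
by case: s => // x s /(_ x (mem_head _ _)) ->.
Qed.

Lemma nat_coloring_of w p : (w, p) \in o -> nat_coloring (coloring_of k) w p = k w.
Proof. by move=> wp; rewrite /nat_coloring coloring_ofE // to_colorK // (numbering_lt wp). Qed.

Lemma proper_coloring_of : proper_coloring (coloring_of k).
Proof.
have inj x y : x < n -> y < n -> to_vertex x = to_vertex y -> x = y.
  by move=> xn yn /(congr1 val) /=; rewrite !to_vertex_val.
have up v p c : (v, p) \in o -> (c, v) \in o -> k v != k c.
  move=> vp cv; have [|_ /= /andP[vN _]] := kP (v := v) _.
    by rewrite inE (map_f (fun e => e.1) vp) orbT.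
  by apply: contraNneq vN => ->; apply: map_f; rewrite mem_children.
move=> e f /edgesP[a [b [ab ->]]] /edgesP[c [d [cd ->]]] ef.
have [an bn] := order_lt ab; have [cn dn] := order_lt cd.
case/set0Pn=> x; rewrite !coloring_ofE // => /setIP[]; rewrite !inE => xab xcd.
suff : k a != k c.
  apply: contra_neq => /(congr1 val) /=.
  by rewrite !to_colorK // (numbering_lt ab, numbering_lt cd).
(* Edges can meet in four ways: at both lower ends, which makes them equal; at the lower end of one
   and the upper end of the other, in two ways; or at both upper ends, where the lower ends are
   siblings. *)
case/orP: xab => /eqP xE; case/orP: xcd => /eqP; rewrite xE => /inj E.
- rewrite E // in ab ef; case/negP: ef.
  by rewrite (parent_unique ab cd).
- by apply: up ab _; rewrite E.
- by rewrite eq_sym; apply: up cd _; rewrite -E.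
have bd : b = d by apply: E.
rewrite bd in ab ef; have [|_ /= /andP[_ uk]] := kP (v := d) _.
  exact: (grown_parent_mem order_grown ab).
have ac : a != c by apply: contraNneq ef => ->.
move: uk; rewrite -!mem_children in ab cd; elim: (children o d) ab cd => //= y s IH.
rewrite !inE => /orP[/eqP ay|as_] /orP[/eqP cy|cs] /andP[ys us].
- by rewrite ay cy eqxx in ac.
- by apply: contraNneq ys; rewrite -ay => ->; apply: map_f.
- by apply: contraNneq ys; rewrite -cy => <-; apply: map_f.
- exact: IH.
Qed.

End ColoringOf.

Theorem solver_correct cc (r := solver cc n C nat_paths cost_table) :
  exists s chi, [/\ enc_coloring s = enc r :> data K, lists_coloring s chi &
    minimizes (@path_cost cc) chi].
Proof.
pose tr := path_triples cc nat_paths.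
pose tab := table C tr cost_table o ((0, n) :: rev o).
pose c0 := root_color C tab; pose k := color_of c0 (recolor tab c0 o).
have [kP kmin] : proper_numbering C o k /\ forall k', proper_numbering C o k' ->
    (coloring_cost n tr cost_table o k <= coloring_cost n tr cost_table o k')%R.
  exact: (recolor_optimal n tr cost_table order_uniq order_parents few_children).
have rE : r = recolor tab c0 o by [].
have rP x : x \in r -> x.1 \in o /\ x.2 = k x.1.1.
  move=> xr; split; first by rewrite -(map_recolor tab c0 o) -rE; apply: map_f.
  rewrite /k -rE /color_of.
  have : uniq [seq y.1 | y <- child_colors r].
    by rewrite map_child_colors; have /andP[] := order_uniq.
  move: (r) xr; elim=> //= y s IH; rewrite inE => /orP[/eqP->|xs] /andP[ys us].
    by rewrite eqxx.
  rewrite -IH //; case: eqP => // yx; case/negP: ys; rewrite yx.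
  by rewrite -map_comp; apply: (map_f (fun x => x.1.1) xs).
exists [seq (to_vertex x.1.1, to_vertex x.1.2, to_color x.2) | x <- r].
exists (coloring_of k); split.
- have {}rP : all (fun x => [&& x.1.1 < n, x.1.2 < n & x.2 < C]) r.
    apply/allP=> -[[w p] c] /rP /= [wp ->].
    by have [-> ->] := order_lt wp; rewrite (numbering_lt kP wp).
  elim: (r) rP => // -[[w p] c] s IH /= /andP[/and3P[wn pn cC] /IH {}IH].
  rewrite /enc_coloring /= !to_vertex_val // to_colorK //.
  by congr DCons.
- split=> [u v c|e].
    case/mapP=> -[[w p] d] /rP /= [wp ->] [-> -> ->]; split.
      by apply/edgesP; exists w, p.
    exact: coloring_ofE.
  case/edgesP=> w [p [wp eE]]; exists (to_vertex w), (to_vertex p), (to_color (k w)).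
  split=> //; have : (w, p) \in [seq x.1 | x <- r] by rewrite rE map_recolor.
  case/mapP=> -[wp' c] xr /= E; rewrite -{wp'}E in xr.
  by apply/mapP; exists (w, p, c) => //=; have [_ /= ->] := rP _ xr.
split; first exact: proper_coloring_of.
move=> chi' /numbering_of_coloring[k' k'P k'E].
rewrite (path_cost_numbering cc k'E) (@path_cost_numbering cc _ k); last first.
  by move=> w p; apply: nat_coloring_of.
exact: kmin.
Qed.

End InstanceData.

(** * Running time of the algorithm *)

Section Numbers.
Variables (K : realDomainType) (sz g : K -> nat).
Hypothesis gD : forall x y, g (x + y)%R <= g x + g y.
Hypothesis sz_g : forall x, sz x <= 2 * g x.
Notation computes := (computes sz).

Lemma pb_sz (G : ctx) (a : car G -> K) :
  poly_bounded (fun x => g (a x)) -> poly_bounded (fun x => sz (a x)).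
Proof. by move=> P; refine (pb_le (pb_mul (pb_const _ 2) P) _) => x _. Qed.

Section Rules.
Context (G : ctx) {S : Type} {eS : encodable K S}.
Implicit Types E : car G -> S.

(** Every addition is charged for the partial sum reached so far; subadditivity of [g] keeps all
    partial sums of polynomial size. *)
Lemma comp_sum (T : eqType) (eT : encodable K T) E (l : car G -> seq T)
    (f : car G -> T -> K) :
  poly_bounded (fun x => size (l x)) ->
  poly_bounded (G := ext_mem l) (fun y => g (f y.1 y.2)) ->
  computes E l ->
  computes (G := ext_mem l) (fun y => (E y.1, y.2)) (fun y => f y.1 y.2) ->
  computes E (fun x => \sum_(t <- l x) f x t)%R.
Proof.
move=> Pl Pf El Ef; apply: (comp_rec (F := fun x s => \sum_(t <- s) f x t)%R) => //.
  apply: (comp_eq (F := fun=> 0%R : K)); last exact: comp_zero.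
  by move=> x _; rewrite big_nil.
pose p (y : car (ext_rec l)) : car (ext_mem l) := (y.1, y.2.1).
have p_ok y : ok y -> ok (p y).
  by case=> y_ok [s ls]; split=> //=; rewrite ls mem_cat mem_head orbT.
apply: (comp_eq (F := fun y : car (ext_rec l) =>
    f y.1 y.2.1 + \sum_(t <- y.2.2) f y.1 t)%R).
  by move=> y _; rewrite big_cons.
apply: comp_addr.
- apply: pb_sz; exact: (pb_sub (s := p)) Pf.
- apply: pb_sz; have [c [d Pcd]] := Pf.
  apply: (pb_le (h2 := fun y : car (ext_rec l) =>
    g 0%R + size (l y.1) * (c * (siz y).+1 ^ d))).
    apply: pb_add; first exact: pb_const.
    by apply: pb_mul; [exact: (pb_ext Pl)|exists c, d].
  move=> [x [t s]] [x_ok [s' /= ls]];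
  apply: leq_trans (size_sum_le gD (B := c * (siz x).+1 ^ d) _) _.
    move=> u us; apply: (Pcd (x, u)); split=> //=.
    by rewrite ls mem_cat inE us !orbT.
  by rewrite leq_add2l leq_mul2r ls size_cat /=; apply/orP; right; lia.
- apply: (comp_sub (s := p)) Ef _ => //.
  by rewrite /p; apply: comp_pair; comp_var.
- by comp_var.
Qed.

(** Each comparison involves the minimum of a tail, which is itself an entry of the list, so a bound
    on the entries suffices. *)
Lemma comp_argmin (T : eqType) (eT : encodable K T) E (d : T) (l : car G -> seq (K * T)) :
  poly_bounded (fun x => size (l x)) ->
  poly_bounded (G := ext_mem l) (fun y => g y.2.1) ->
  computes E (fun=> d) -> computes E l -> computes E (fun x => argmin d (l x)).
Proof.
move=> Pl Pf Ed El; apply: (comp_rec (F := fun x s => argmin d s)) => //.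
  by apply: comp_pair => //; apply: comp_zero.
rewrite /=; apply: comp_nilp; [comp_var|comp_var|].
apply: comp_if; try comp_var.
apply: comp_ler; try comp_var; apply: pb_sz.
  apply: (pb_sub (s := fun y : car (ext_rec l) => (y.1, y.2.1) : car (ext_mem l))) Pf => //.
  by move=> y [y_ok [s ls]]; split=> //=; rewrite ls mem_cat mem_head orbT.
have [c [e Pce]] := Pf.
refine (pb_le (h2 := fun y : car (ext_rec l) => g 0%R + c * (siz y).+1 ^ e) _ _).
  by apply: pb_add; [exact: pb_const|exists c, e].
move=> [x [t s]] [x_ok [s' /= ls]]; case: (s =P [::]) => [->|/eqP s0].
  exact: leq_addr.
apply: leq_trans (leq_addl _ _); apply: (Pce (x, argmin d s)); split=> //=.
by rewrite ls mem_cat inE argmin_mem ?orbT.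
Qed.

Lemma comp_nth T (eT : encodable K T) E (d : car G -> T) (s : car G -> seq T) (i : car G -> nat) :
  poly_bounded i -> computes E d -> computes E s -> computes E i ->
  computes E (fun x => nth (d x) (s x) (i x)).
Proof.
move=> Pi Ed Es Ei.
apply: (comp_eq (F := fun x => head (d x) (iter (i x) behead (s x)))).
  by move=> x _; elim: (i x) (s x) => [|j IH] [|a l] //; rewrite iterSr -IH ?nth_nil.
apply: comp_head => //; apply: (comp_iter (f := fun=> behead) (P := fun _ _ => True)) => //.
by apply: comp_behead; comp_var.
Qed.

End Rules.

Lemma comp_undup_triples (G : ctx) (S : Type) (eS : encodable K S) (E : car G -> S)
    (l : car G -> seq (nat * (nat * nat))) (h : car G -> nat) :
  poly_bounded h -> poly_bounded (fun x => size (l x)) ->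
  (forall x, ok x -> {in l x, forall t, [/\ t.1 < h x, t.2.1 < h x & t.2.2 < h x]}) ->
  computes E l -> computes E (fun x => undup (l x)).
Proof.
move=> Ph Pl bnd El; apply: (comp_rec (F := fun x s => undup s)) => //.
  exact: comp_Nil.
pose same (t u : nat * (nat * nat)) := [&& u.1 == t.1, u.2.1 == t.2.1 & u.2.2 == t.2.2].
apply: (comp_eq (F := fun y : car (ext_rec l) =>
  if has (same y.2.1) y.2.2 then undup y.2.2 else y.2.1 :: undup y.2.2)).
  by move=> [x [t s]] _ /=; rewrite -has_pred1.
apply: comp_if; [|comp_var|by apply: comp_Cons; comp_var].
apply: (comp_has (p := fun (y : car (ext_rec l)) u => same y.2.1 u)).
- exact: pb_ext_rec.
- by comp_var.
apply: comp_and; [|apply: comp_and]; apply: comp_eqn; try comp_var;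
  refine (pb_le (pb_ext (pb_ext Ph)) _) => -[[x [t s]] u] [[x_ok [s' /= ls]] _];
  have [|] := bnd x x_ok t; rewrite ?ls ?mem_cat ?mem_head ?orbT //= => *; lia.
Qed.

End Numbers.

Lemma size_flatten_le (T : eqType) (ss : seq (seq T)) m :
  {in ss, forall s, size s <= m} -> size (flatten ss) <= size ss * m.
Proof.
elim: ss => //= s ss IH le; rewrite size_cat mulSn leq_add ?le ?mem_head //.
by apply: IH => s' ss'; apply: le; rewrite inE ss' orbT.
Qed.

Lemma size_pairs_le (T : Type) (s : seq T) : size (pairs s) <= size s.
Proof. by rewrite size_zip geq_minl. Qed.

Lemma size_triples_le (T : Type) (s : seq T) : size (triples s) <= size s.
Proof. by rewrite size_zip geq_minl. Qed.

Lemma look_lt (a : seq (nat * nat)) u m : 0 < m -> all (fun t => t.2 < m) a ->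
  look 0 u a < m.
Proof. by move=> m0; elim: a => //= t a IH /andP[tm /IH]; case: eqP. Qed.

(** * Time analysis of the solver *)

Section Complexity.
Variables (K : realDomainType) (sz g : K -> nat) (b : {poly nat}) (cc : bool).
Hypothesis gD : forall x y, g (x + y)%R <= g x + g y.
Hypothesis sz_g : forall x, sz x <= 2 * g x.
Hypothesis g_sz : forall x, g x <= sz x.
Notation computes := (computes sz).

Definition instances : ctx :=
  @Ctx (instance K) (fun I => valid_instance I /\ tree_with_few_colorings sz b I)
    (input_size sz).
Local Notation G := instances.
Implicit Types I : instance K.

Lemma leq_data_size_nat m : m <= data_size sz (enc_nat K m).
Proof. by elim: m => //= m IH; rewrite ltnS (leq_trans IH) // leq_addl. Qed.

Lemma data_size_pair S T (eS : encodable K S) (eT : encodable K T) (x : S) (y : T) :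
  data_size sz (enc (x, y)) = (data_size sz (enc x) + data_size sz (enc y)).+1.
Proof. by []. Qed.

Lemma leq_data_size_seq T (eT : encodable K T) (s : seq T) :
  size s <= data_size sz (enc s).
Proof. by elim: s => //= a s IH; rewrite ltnS (leq_trans IH) // leq_addl. Qed.

Lemma data_size_mem (T : eqType) (eT : encodable K T) (s : seq T) x : x \in s ->
  data_size sz (enc x) <= data_size sz (enc s).
Proof.
elim: s => // a s IH; rewrite [data_size _ (enc (_ :: _))]/= inE.
case/orP=> [/eqP->|/IH le]; first by rewrite leqW // leq_addr.
by rewrite leqW // (leq_trans le) // leq_addl.
Qed.

(** A copy of the instance without dependent types. By [enc_input] it has the same encoding, so
    computing from it is computing from the actual input. *)
Definition input I := (nvert I, (ncol I, (nat_paths I, cost_table I))).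

Lemma enc_seq_map T U (e : U -> data K) (f : T -> U) s :
  enc_seq e [seq f x | x <- s] = enc_seq (fun x => e (f x)) s.
Proof. by elim: s => //= x s ->. Qed.

Lemma eq_enc_seq T (e1 e2 : T -> data K) s : e1 =1 e2 -> enc_seq e1 s = enc_seq e2 s.
Proof. by move=> e12; elim: s => //= x s ->; rewrite e12. Qed.

Lemma enc_input I : enc (input I) = enc_instance I.
Proof.
congr (DCons _ (DCons _ (DCons _ _))); rewrite [LHS]enc_seq_map; apply: eq_enc_seq => x;
exact: enc_seq_map.
Qed.

Lemma input_sizeE I : input_size sz I = data_size sz (enc (input I)).
Proof. by rewrite enc_input. Qed.

Lemma nvert_le I : nvert I <= input_size sz I.
Proof. by have := leq_data_size_nat (nvert I); rewrite /input_size /=; lia. Qed.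

Lemma ncol_le I : ncol I <= input_size sz I.
Proof. by have := leq_data_size_nat (ncol I); rewrite /input_size /=; lia. Qed.

Lemma size_paths_le I : size (nat_paths I) <= input_size sz I.
Proof.
rewrite input_sizeE !data_size_pair.
have : size (nat_paths I) <= data_size sz (enc (nat_paths I)) by apply: leq_data_size_seq.
lia.
Qed.

Lemma size_path_le I P : P \in nat_paths I -> size P <= input_size sz I.
Proof.
move=> PI; rewrite input_sizeE !data_size_pair.
have : data_size sz (enc P) <= data_size sz (enc (nat_paths I)) by apply: data_size_mem.
have : size P <= data_size sz (enc P) by apply: leq_data_size_seq.
lia.
Qed.

Lemma tcost_le I i j : g (tcost (cost_table I) i j) <= g 0%R + input_size sz I.
Proof.
rewrite /tcost; set r := nth _ _ i.
have [jr|] := ltnP j (size r); last by move=> jr; rewrite nth_default ?leq_addr.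
have [ir|] := ltnP i (size (cost_table I)); last first.
  by move=> ir; move: jr; rewrite /r nth_default.
have rI : r \in cost_table I by apply: mem_nth.
apply: leq_trans (g_sz _) (leq_trans _ (leq_addl _ _)).
rewrite input_sizeE !data_size_pair.
have : data_size sz (enc r) <= data_size sz (enc (cost_table I)) by apply: data_size_mem.
have : data_size sz (enc (nth 0%R r j)) <= data_size sz (enc r).
  by apply: data_size_mem; apply: mem_nth.
have -> : data_size sz (enc (nth 0%R r j)) = (sz (nth 0%R r j)).+1 by [].
lia.
Qed.

Lemma pb_nvert : poly_bounded (G := G) (fun I => nvert I).
Proof. by apply: pb_le (pb_siz _) _ => I _; apply: nvert_le. Qed.

Lemma pb_ncol : poly_bounded (G := G) (fun I => ncol I).
Proof. by apply: pb_le (pb_siz _) _ => I _; apply: ncol_le. Qed.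

Lemma pb_arcs : poly_bounded (G := G) (fun I => size (path_arcs (nat_paths I))).
Proof.
apply: pb_le (pb_mul (pb_const _ 2) (pb_mul (pb_siz _) (pb_siz _))) _ => I _ /=.
rewrite /path_arcs size_cat size_map addnn -mul2n leq_mul2l /=.
apply: leq_trans (size_flatten_le (m := input_size sz I) _) _.
  move=> s /mapP[P PI ->]; apply: leq_trans (size_pairs_le _) _; exact: size_path_le.
by rewrite size_map leq_mul2r size_paths_le orbT.
Qed.

Lemma pb_triples cc' : poly_bounded (G := G) (fun I => size (path_triples cc' (nat_paths I))).
Proof.
apply: pb_le (pb_mul (pb_siz _) (pb_siz _)) _ => I _ /=.
apply: leq_trans (_ : size (flatten [seq triples P | P <- nat_paths I]) <= _).
  by rewrite /path_triples; case: cc' => //; apply: size_undup.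
apply: leq_trans (size_flatten_le (m := input_size sz I) _) _.
  move=> s /mapP[P PI ->]; apply: leq_trans (size_triples_le _) _; exact: size_path_le.
by rewrite size_map leq_mul2r size_paths_le orbT.
Qed.

Lemma comp_input_nvert : computes (G := G) input (fun I => nvert I).
Proof. by rewrite /input; comp_var. Qed.
Lemma comp_input_paths : computes (G := G) input (fun I => nat_paths I).
Proof. by rewrite /input; comp_var. Qed.
Lemma comp_arcs : computes (G := G) input (fun I => path_arcs (nat_paths I)).
Proof.
have Ef : computes (G := G) input (fun I => flatten [seq pairs P | P <- nat_paths I]).
  apply: comp_flatten.
  - by apply: pb_le (pb_siz _) _ => I _; rewrite size_map; apply: size_paths_le.
  - refine (pb_le (pb_siz _) _) => -[I s] [_ /mapP[P PI /= ->]].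
    by apply: leq_trans (size_pairs_le _) _; apply: size_path_le.
  apply: (comp_map (f := fun _ P => pairs P)).
  - by apply: pb_le (pb_siz _) _ => I _; apply: size_paths_le.
  - exact: comp_input_paths.
  apply: comp_pairs; last by comp_var.
  by refine (pb_le (pb_siz _) _) => -[I P] [_ PI]; apply: size_path_le.
have Pf : poly_bounded (G := G) (fun I => size (flatten [seq pairs P | P <- nat_paths I])).
  by apply: pb_le pb_arcs _ => I _; rewrite /path_arcs size_cat leq_addr.
apply: comp_cat => //; apply: (comp_map (f := fun _ e => (e.2, e.1))) => //.
by apply: comp_pair; comp_var.
Qed.

Lemma triples_lt I : ok (c := G) I -> {in path_triples false (nat_paths I),
  forall t, [/\ t.1 < nvert I, t.2.1 < nvert I & t.2.2 < nvert I]}.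
Proof.
move=> _ t; rewrite nat_triplesE => /mapP[[x [y z]] _ ->] /=.
by split; apply: ltn_ord.
Qed.

Lemma comp_path_triples : computes (G := G) input (fun I => path_triples cc (nat_paths I)).
Proof.
have Ef : computes (G := G) input (fun I => path_triples false (nat_paths I)).
  apply: comp_flatten.
  - by apply: pb_le (pb_siz _) _ => I _; rewrite size_map; apply: size_paths_le.
  - refine (pb_le (pb_siz _) _) => -[I s] [_ /mapP[P PI /= ->]].
    by apply: leq_trans (size_triples_le _) _; apply: size_path_le.
  apply: (comp_map (f := fun _ P => triples P)).
  - by apply: pb_le (pb_siz _) _ => I _; apply: size_paths_le.
  - exact: comp_input_paths.
  apply: comp_triples; last by comp_var.
  by refine (pb_le (pb_siz _) _) => -[I P] [_ PI]; apply: size_path_le.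
case: cc => //; apply: (comp_undup_triples pb_nvert (pb_triples false)) => //.
exact: triples_lt.
Qed.

Lemma comp_order : computes (G := G) input (fun I => inst_order I).
Proof.
apply: comp_trans (comp_pair comp_input_nvert comp_arcs) _.
rewrite /inst_order /search_order.
(* The invariant [grown] keeps the state shorter than [nvert I], which bounds the time of a
   round. *)
apply: (comp_iter (G := G) (n := fun I => nvert I) (z := fun=> [::])
  (f := fun I o => grow (path_arcs (nat_paths I)) o)
  (P := fun I o => grown (path_arcs (nat_paths I)) o)) => //.
- by move=> I o _; apply: grown_grow.
- exact: pb_nvert.
- by comp_var.
- exact: comp_Nil.
set GO := ext _; have Po : poly_bounded (G := GO) (fun y => size (vertices y.2)).
  refine (pb_le (pb_ext pb_nvert) _) => -[I o] [[Iv [It _]] /=].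
  rewrite size_map; apply: (grown_size (nvert_gt0 It)); exact: arcs_lt.
have Pf : poly_bounded (G := GO) (fun y => size (path_arcs (nat_paths y.1))).
  exact: (pb_ext pb_arcs).
have Ef : computes (G := GO) (fun y => ((nvert y.1, path_arcs (nat_paths y.1)), y.2))
    (fun y => frontier (path_arcs (nat_paths y.1)) y.2).
  have Ev : computes (G := GO) (fun y => ((nvert y.1, path_arcs (nat_paths y.1)), y.2))
      (fun y => vertices y.2).
    apply: comp_Cons; first exact: comp_0.
    apply: (comp_map (f := fun _ e => e.1)); [|comp_var|comp_var].
    by refine (pb_le Po _) => y _; rewrite /= size_map leqnSn.
  apply: (comp_filter (p := fun (y : car GO) e =>
    (e.1 \in vertices y.2) && (e.2 \notin vertices y.2))) => //.
    by comp_var.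
  have Pe : poly_bounded (G := ext_mem (fun y : car GO => path_arcs (nat_paths y.1)))
      (fun z => nvert z.1.1) by exact: (pb_ext (pb_ext pb_nvert)).
  apply: comp_and; [|apply: comp_neg]; apply: comp_mem; try comp_var; try comp_hyp Ev;
    try exact: (pb_ext Po);
    by refine (pb_le Pe _) => -[[I o] [u v]] [_ /arcs_lt[/= /ltnW un /ltnW vn]].
apply: comp_let Ef _.
rewrite /grow; apply: comp_nilp; [comp_var|comp_var|].
apply: comp_Cons; last by comp_var.
apply: comp_pair; [apply: comp_snd|apply: comp_fst]; apply: comp_head; try comp_var;
  by apply: comp_pair; apply: comp_0.
Qed.


Local Notation tr I := (path_triples cc (nat_paths I)).
Definition layout I := (0, nvert I) :: rev (inst_order I).
Definition partial_table I q :=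
  table (ncol I) (tr I) (cost_table I) (inst_order I) q.
Definition prepared I := (input I, (tr I, inst_order I)).

Lemma comp_prepared : computes (G := G) input prepared.
Proof.
apply: comp_pair (comp_refl _ _) (comp_pair _ _); first exact: comp_path_triples.
exact: comp_order.
Qed.

Lemma pb_order : poly_bounded (G := G) (fun I => size (inst_order I)).
Proof. by apply: pb_le pb_nvert _ => I [Iv [It _]]; apply/ltnW/order_size. Qed.

Lemma pb_layout : poly_bounded (G := G) (fun I => size (layout I)).
Proof.
apply: pb_le (pb_add (pb_const _ 1) pb_order) _ => I _.
by rewrite /= size_rev.
Qed.

Definition entry_bound I :=
  (size (inst_order I)).+1 * ((size (tr I)).+2 * (g 0%R + input_size sz I)).

Lemma pb_entry_bound : poly_bounded (G := G) entry_bound.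
Proof.
apply: pb_le (pb_mul (pb_add (pb_const _ 1) pb_order) (pb_mul
  (pb_add (pb_const _ 2) (pb_triples cc)) (pb_add (pb_const _ (g 0%R)) (pb_siz _)))) _ => I _.
by rewrite /entry_bound !addSn !add0n.
Qed.

(** On its own keys a partial table agrees with the finished one, to which [entry_size] applies. *)
Lemma partial_entry_le I q1 q w i : ok (c := G) I -> layout I = q1 ++ q ->
  w \in [seq e.1 | e <- q] -> i < ncol I ->
  g (entry (partial_table I q) w i).1 <= entry_bound I.
Proof.
move=> [Iv [It _]] lE wq iC.
have u : uniq [seq e.1 | e <- q1 ++ q].
  by rewrite -lE; apply: (uniq_keys_bo (nvert I) (order_uniq _)).
have wk : w \in 0 :: [seq e.1 | e <- inst_order I].
  by rewrite -(mem_keys_bo (nvert I)) -/(layout I) lE map_cat mem_cat wq orbT.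
rewrite /entry /partial_table -(look_table _ _ _ _ u wq) -lE.
apply: (@entry_size K (nvert I) _ _ _ _ _ _ _ g (g 0%R + input_size sz I)) => //.
- exact: order_uniq.
- exact: order_parents.
- exact: few_children.
- exact: root_parent.
- exact: leq_addr.
- exact: tcost_le.
Qed.

Local Notation GT := (ext_rec (G := instances) layout).
Local Notation vtx y := (y.2.1.1).
Local Notation par y := (y.2.1.2).

Definition row_env (y : car GT) := (prepared y.1, (y.2, partial_table y.1 y.2.2)).

Lemma layout_split (y : car GT) : ok y -> exists q1, layout y.1 = q1 ++ y.2.1 :: y.2.2.
Proof. by case. Qed.

Lemma vtx_key (y : car GT) : ok y -> vtx y \in 0 :: [seq e.1 | e <- inst_order y.1].
Proof.
move=> /layout_split[q1 lE].
by rewrite -(mem_keys_bo (nvert y.1)) -/(layout y.1) lE map_cat mem_cat /= mem_head orbT.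
Qed.

Lemma vtx_lt (y : car GT) : ok y -> vtx y < nvert y.1.
Proof.
move=> y_ok; have := vtx_key y_ok; case: y_ok => -[Iv [It _]] _.
by rewrite -/(vertices _) order_complete.
Qed.

(** Restricted to genuine assignments: their keys are children with rows already present and their
    colors are below [ncol], so the entries looked up have bounded size. *)
Definition candidates : ctx := ext (G := GT) (fun y ca =>
  ca.1 < ncol y.1 /\ assignment (ncol y.1) (inst_order y.1) (vtx y) ca.1 ca.2).
Local Notation GC := candidates.

Lemma size_assignment (z : car GC) : ok z -> size z.2.2 <= nvert z.1.1.
Proof.
case=> -[[Iv [It _]] _] [_ /and3P[/eqP aE _ _]].
rewrite -(size_map (fun t => t.1)) aE size_map; apply: leq_trans (ltnW (order_size It)).
by rewrite size_filter count_size.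
Qed.

Lemma assignment_entry_le (z : car GC) t : ok z -> t \in z.2.2 ->
  [/\ t.1 < nvert z.1.1, t.2 < ncol z.1.1 &
   g (entry (partial_table z.1.1 z.1.2.2) t.1 t.2).1 <= entry_bound z.1.1].
Proof.
move=> -[y_ok [_ /and3P[/eqP aE /allP aC _]]] ta.
have [q1 lE] := layout_split y_ok; have [I_ok _] := y_ok; have [Iv [It _]] := I_ok.
have tch : t.1 \in children (inst_order z.1.1) z.1.2.1.1.
  by rewrite -aE; apply: map_f.
split; last 1 first.
- rewrite -cat_rcons in lE.
  apply: (partial_entry_le I_ok lE); last exact: aC.
  apply: (children_later (order_uniq _) (@order_parents _ _) (n := nvert z.1.1) _ tch).
  by rewrite -/(layout _) lE cat_rcons.
- by move: tch; rewrite mem_children => /order_lt[].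
- exact: aC.
Qed.

Lemma candidate_cost_le (z : car GC) : ok z ->
  g (candidate_cost (tr z.1.1) (cost_table z.1.1) (partial_table z.1.1 z.1.2.2)
       (vtx z.1) (par z.1) z.2.1 z.2.2) <=
  (size (tr z.1.1)).+1 * (g 0%R + input_size sz z.1.1) +
  (g 0%R + nvert z.1.1 * entry_bound z.1.1).
Proof.
move=> z_ok; apply: leq_trans (gD _ _) _; apply: leq_add.
  apply: size_local_cost => //; first exact: leq_addr.
  exact: tcost_le.
apply: leq_trans (size_sum_le gD (B := entry_bound z.1.1) _) _.
  by move=> t /(assignment_entry_le z_ok)[].
by rewrite leq_add2l leq_mul2r size_assignment ?orbT.
Qed.

Lemma pb_candidate_cost : poly_bounded (G := GC) (fun z =>
  g (candidate_cost (tr z.1.1) (cost_table z.1.1) (partial_table z.1.1 z.1.2.2)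
       (vtx z.1) (par z.1) z.2.1 z.2.2)).
Proof.
apply: pb_le candidate_cost_le; apply: pb_add.
  apply: pb_mul; last by apply: pb_add; [exact: pb_const|exact: pb_siz].
  refine (pb_le (pb_add (pb_const _ 1) (pb_ext (pb_ext (pb_triples cc)))) _).
  by move=> z _; rewrite add1n.
apply: pb_add; first exact: pb_const.
by apply: pb_mul; [exact: (pb_ext (pb_ext pb_nvert))|exact: (pb_ext (pb_ext pb_entry_bound))].
Qed.

Lemma pb_size_assignment : poly_bounded (G := GC) (fun z => size z.2.2).
Proof. by refine (pb_le (pb_ext (pb_ext pb_nvert)) _) => z /size_assignment. Qed.

Lemma comp_tcost (G' : ctx) (S : Type) (eS : encodable K S) (E : car G' -> S)
    (tb : car G' -> seq (seq K)) (i j : car G' -> nat) :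
  poly_bounded i -> poly_bounded j -> computes E tb -> computes E i -> computes E j ->
  computes E (fun x => tcost (tb x) (i x) (j x)).
Proof.
move=> Pi Pj Et Ei Ej; apply: comp_nth => //; first exact: comp_zero.
by apply: comp_nth => //; apply: comp_Nil.
Qed.

Lemma pb_partial_table : poly_bounded (G := GT) (fun y => size (partial_table y.1 y.2.2)).
Proof.
refine (pb_le (pb_ext_rec pb_layout) _) => y _.
by elim: (y.2.2) => //= e q IH; rewrite ltnS.
Qed.

Lemma size_row I q v : size (look [::] v (partial_table I q)) <= ncol I.
Proof.
elim: q => //= e q IH; case: ifP => // _.
by rewrite /best_row size_map size_down.
Qed.

Lemma comp_candidate_cost : computes (G := GC) (fun z => (row_env z.1, z.2)) (fun z =>
  candidate_cost (tr z.1.1) (cost_table z.1.1) (partial_table z.1.1 z.1.2.2)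
       (vtx z.1) (par z.1) z.2.1 z.2.2).
Proof.
have Pn := pb_ext (pb_ext pb_nvert) : poly_bounded (G := GC) (fun z => nvert z.1.1).
have PC := pb_ext (pb_ext pb_ncol) : poly_bounded (G := GC) (fun z => ncol z.1.1).
have Ptr := pb_ext (pb_ext (pb_triples cc)) : poly_bounded (G := GC) (fun z => size (tr z.1.1)).
have Pentry := pb_ext (pb_ext pb_entry_bound) : poly_bounded (G := GC) (fun z => entry_bound z.1.1).
have Pa := pb_size_assignment.
rewrite /row_env /prepared /input; apply: comp_addr.
- apply: (pb_sz sz_g); refine (pb_le (pb_mul (pb_add (pb_const _ 1) Ptr)
    (pb_add (pb_const _ (g 0%R)) (pb_siz _))) _) => z _.
  rewrite add1n; apply: size_local_cost => //; first exact: leq_addr.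
  exact: tcost_le.
- apply: (pb_sz sz_g); refine (pb_le (pb_add (pb_const _ (g 0%R)) (pb_mul Pn Pentry)) _) => z z_ok.
  apply: leq_trans (size_sum_le gD (B := entry_bound z.1.1) _) _.
    by move=> t /(assignment_entry_le z_ok)[].
  by rewrite leq_add2l leq_mul2r size_assignment ?orbT.
- rewrite /local_cost; pose l (z : car GC) := tr z.1.1.
  pose a (z : car GC) := (par z.1, z.2.1) :: z.2.2.
  apply: (comp_sum gD sz_g (l := l) (f := fun z t => if t.2.1 == vtx z.1 then
    tcost (cost_table z.1.1) (look 0 t.1 (a z)) (look 0 t.2.2 (a z)) else 0%R)) => //.
  + refine (pb_le (pb_add (pb_const _ (g 0%R)) (pb_siz _)) _) => -[z t] _ /=.
    by case: ifP => _; [exact: tcost_le|exact: leq_addr].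
  + by rewrite /l; comp_var.
  have lookP (u : car (ext_mem l) -> nat) :
      poly_bounded (G := ext_mem l) (fun x => look 0 (u x) (a x.1)).
    refine (pb_le (pb_ext PC) _) => -[z t] [[[[Iv [It _]] _] [cC /and3P[_ aC _]]] _] /=.
    apply: ltnW; apply: (@look_lt (a z)); first exact: ncol_gt0.
    by rewrite /= cC.
  have tn (x : car (ext_mem l)) : ok x -> x.2.1 <= nvert x.1.1.1 /\ x.2.2.2 <= nvert x.1.1.1.
    case: x => z t [[[I_ok _] _]] /= tl; have : t \in path_triples false (nat_paths z.1.1).
      by move: tl; rewrite /l /path_triples; case: (cc); rewrite ?mem_undup.
    by case/(triples_lt I_ok) => /ltnW ? _ /ltnW.
  have Pa' : poly_bounded (G := ext_mem l) (fun x => size (a x.1)).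
    by refine (pb_le (pb_add (pb_const _ 1) (pb_ext Pa)) _) => x _; rewrite add1n.
  apply: comp_if; last exact: comp_zero.
    apply: comp_eqn; try comp_var.
    by refine (pb_le (pb_ext Pn) _) => -[z t] [[y_ok _] _]; apply/ltnW/vtx_lt.
  have Ea : computes (G := ext_mem l)
    (fun y => (input y.1.1.1, (tr y.1.1.1, inst_order y.1.1.1),
     (y.1.1.2, partial_table y.1.1.1 y.1.1.2.2), y.1.2, y.2)) (fun x => a x.1).
    by rewrite /a; apply: comp_Cons; [apply: comp_pair|]; comp_var.
  rewrite /input in Ea.
  apply: comp_tcost => //; try comp_var; apply: comp_look => //; try comp_var;
    try exact: comp_0; by refine (pb_le (pb_ext Pn) _) => x /tn[].
- apply: (comp_sum gD sz_g (l := fun z : car GC => z.2.2)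
    (f := fun z t => (entry (partial_table z.1.1 z.1.2.2) t.1 t.2).1)) => //.
  + by refine (pb_le (pb_ext Pentry) _) => -[z t] [z_ok] /(assignment_entry_le z_ok)[].
  + by comp_var.
  have tP (x : car (ext_mem (fun z : car GC => z.2.2))) : ok x ->
      x.2.1 <= nvert x.1.1.1 /\ x.2.2 <= ncol x.1.1.1.
    by case: x => z t [z_ok] /(assignment_entry_le z_ok)[/ltnW ? /ltnW].
  apply: comp_fst; rewrite /entry; apply: comp_look; try comp_var.
  + by refine (pb_le (pb_ext PC) _) => x /tP[].
  + by refine (pb_le (pb_ext PC) _) => x _; apply: size_row.
  + by apply: comp_pair; [exact: comp_zero|exact: comp_Nil].
  apply: comp_look; try comp_var; last exact: comp_Nil.
  + by refine (pb_le (pb_ext Pn) _) => x /tP[].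
  + exact: (pb_ext (pb_ext pb_partial_table)).
Qed.


Lemma comp_children (G' : ctx) (S : Type) (eS : encodable K S) (E : car G' -> S)
    (o : car G' -> seq (nat * nat)) (v : car G' -> nat) :
  poly_bounded v -> poly_bounded (fun x => size (o x)) ->
  computes E o -> computes E v -> computes E (fun x => children (o x) (v x)).
Proof.
move=> Pv Po Eo Ev; apply: (comp_map (f := fun _ e => e.1)); last by comp_var.
  by apply: pb_le Po _ => x _; rewrite size_filter count_size.
apply: (comp_filter (p := fun x e => e.2 == v x)) => //.
by apply: comp_eqn; [exact: (pb_ext Pv)|comp_var|comp_hyp Ev].
Qed.

(** This is where the assumption on |X|^Delta is spent: a vertex has at most [max_degree]
    children. *)
Lemma pb_assignments : poly_bounded (G := GT) (fun y =>
  size (down (ncol y.1)) ^ size (children (inst_order y.1) (vtx y))).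
Proof.
refine (pb_le (pb_ext (pb_poly b (pb_siz instances))) _) => y y_ok.
have vk := vtx_key y_ok; case: (y_ok) => -[Iv [It few]] _; rewrite size_down.
apply: leq_trans few; apply: leq_pexp2l; first exact: ncol_gt0.
exact: size_children_degree.
Qed.

Lemma comp_row : computes (G := GT) row_env (fun y =>
  best_row (ncol y.1) (tr y.1) (cost_table y.1) (inst_order y.1)
    (partial_table y.1 y.2.2) (vtx y) (par y)).
Proof.
have Pv : poly_bounded (G := GT) (fun y => vtx y).
  by refine (pb_le (pb_ext pb_nvert) _) => y /vtx_lt/ltnW.
have PC := pb_ext pb_ncol : poly_bounded (G := GT) (fun y => ncol y.1).
have Pch : poly_bounded (G := GT) (fun y => size (children (inst_order y.1) (vtx y))).
  refine (pb_le (pb_ext pb_order) _) => y _.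
  by rewrite size_map size_filter count_size.
have Pdown : poly_bounded (G := GT) (fun y => size (down (ncol y.1))).
  by refine (pb_le PC _) => y _; rewrite size_down.
rewrite /best_row;
pose all_a (y : car GT) := assignments (down (ncol y.1)) (children (inst_order y.1) (vtx y)).
have Pall : poly_bounded (G := GT) (fun y => size (all_a y)).
  by refine (pb_le pb_assignments _) => y _; rewrite size_assignments.
have Ed : computes (G := GT) row_env (fun y => down (ncol y.1)).
  by apply: comp_down => //; rewrite /row_env /prepared /input; comp_var.
have Ea : computes (G := GT) row_env all_a.
  apply: comp_assignments => //; first exact: pb_assignments.
  apply: comp_children => //; first exact: (pb_ext pb_order);
    by rewrite /row_env /prepared /input; comp_var.
apply: comp_let Ea _.
pose valid_a (y : car GT) c := [seq a <- all_a y | uniq (c :: [seq t.2 | t <- a])].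
pose scored (y : car GT) c := [seq (candidate_cost (tr y.1) (cost_table y.1)
  (partial_table y.1 y.2.2) (vtx y) (par y) c a, a) | a <- valid_a y c].
apply: (comp_map (l := fun y : car GT => down (ncol y.1))
  (f := fun y c => (c, argmin [::] (scored y c)))) => //.
  by refine (comp_trans _ Ed); comp_var.
set GD := ext_mem _.
have candP (z : car GD) a : ok z -> a \in valid_a z.1 z.2 ->
    ok (c := GC) (z.1, (z.2, a)).
  case=> y_ok /[!mem_down] cC; rewrite mem_filter mem_assignments => /and3P[ua /eqP aE aC].
  split=> //; split=> //; apply/and3P; split=> //; first exact/eqP.
  by apply/allP=> t /(allP aC); rewrite mem_down.
have Pvalid : poly_bounded (G := GD) (fun z => size (valid_a z.1 z.2)).
  refine (pb_le (pb_ext Pall) _) => z _.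
  by rewrite size_filter count_size.
apply: comp_pair; first by comp_var.
apply: (comp_argmin sz_g) => //.
- by refine (pb_le Pvalid _) => z _; rewrite size_map.
- have [c [d Pcd]] := pb_candidate_cost; exists c, d.
  by move=> -[z t] [z_ok] /mapP[a av ->] /=; apply: Pcd (candP _ _ z_ok av).
- exact: comp_Nil.
apply: (comp_map (l := fun z : car GD => valid_a z.1 z.2) (f := fun z a =>
  (candidate_cost (tr z.1.1) (cost_table z.1.1)
     (partial_table z.1.1 z.1.2.2) (vtx z.1) (par z.1) z.2 a, a))) => //.
  apply: (comp_filter (l := fun z : car GD => all_a z.1)
    (p := fun z a => uniq (z.2 :: [seq t.2 | t <- a]))).
  - exact: (pb_ext Pall).
  - by comp_var.
  have Pu : poly_bounded (G := ext_mem (fun z : car GD => all_a z.1)) (fun u => size u.2).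
    refine (pb_le (pb_ext (pb_ext Pch)) _) => -[z a] [_] /=.
    by rewrite mem_assignments => /andP[/eqP <- _]; rewrite size_map.
  apply: comp_uniq.
  - refine (pb_le (pb_add (pb_const _ 1) Pu) _) => u _.
    by rewrite /= size_map add1n.
  - refine (pb_le (pb_ext (pb_ext (pb_ext PC))) _) => -[[z a] i] [[[_ /= zC] aA]] /=.
    rewrite inE => /orP[/eqP->|/mapP[t ta ->]]; first by rewrite ltnW // -mem_down.
    move: aA; rewrite mem_assignments => /andP[_ /allP /(_ t ta)].
    by rewrite mem_down => /ltnW.
  apply: comp_Cons; first by comp_var.
  by apply: (comp_map (f := fun _ t => t.2)); [|comp_var|comp_var].
apply: comp_pair; last by comp_var.
apply: (comp_sub (s := fun u : car (ext_mem (fun z : car GD => valid_a z.1 z.2)) =>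
    ((u.1.1, (u.1.2, u.2)) : car GC))) comp_candidate_cost _ => //.
  by move=> -[z a] [z_ok /= az]; apply: candP.
by rewrite /=; apply: comp_pair; [|apply: comp_pair]; comp_var.
Qed.

Local Notation full_table I := (partial_table I (layout I)).

Lemma comp_table : computes (G := G) prepared (fun I => full_table I).
Proof.
apply: (comp_rec (G := instances) (l := layout) (F := partial_table)).
- exact: pb_layout.
- rewrite /layout /prepared /input; apply: comp_Cons.
    by apply: comp_pair; [exact: comp_0|comp_var].
  by apply: comp_rev; [exact: pb_order|comp_var].
- exact: comp_Nil.
rewrite -/row_env /=; apply: comp_Cons; last by rewrite /row_env; comp_var.
by apply: comp_pair; [rewrite /row_env; comp_var|exact: comp_row].
Qed.

Lemma full_table_size I : size (full_table I) = size (layout I).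
Proof. by rewrite /partial_table; elim: (layout I) => //= e q ->. Qed.

Lemma pb_full_table : poly_bounded (G := G) (fun I => size (full_table I)).
Proof. by apply: pb_le pb_layout _ => I _; rewrite full_table_size. Qed.

Definition tabulated I := (prepared I, full_table I).

Lemma comp_tabulated : computes (G := G) input tabulated.
Proof. by apply: comp_trans comp_prepared _; apply: comp_pair comp_table; apply: comp_refl. Qed.

Local Notation root I := (root_color (ncol I) (full_table I)).

Lemma comp_entry (G' : ctx) (S : Type) (eS : encodable K S) (E : car G' -> S)
    (s : car G' -> instance K) (v c : car G' -> nat) :
  poly_bounded (fun x => ncol (s x)) -> poly_bounded (fun x => size (full_table (s x))) ->
  poly_bounded v -> poly_bounded c ->
  computes E (fun x => full_table (s x)) -> computes E v -> computes E c ->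
  computes E (fun x => entry (full_table (s x)) (v x) (c x)).
Proof.
move=> PC Pt Pv Pc Et Ev Ec; apply: comp_look => //.
- by apply: pb_le PC _ => x _; apply: size_row.
- by apply: comp_pair; [exact: comp_zero|exact: comp_Nil].
- by apply: comp_look => //; apply: comp_Nil.
Qed.

Lemma comp_root : computes (G := G) tabulated (fun I => root I).
Proof.
have Pdown : poly_bounded (G := G) (fun I => size (down (ncol I))).
  by apply: pb_le pb_ncol _ => y _; rewrite size_down.
apply: comp_snd; apply: (comp_argmin sz_g).
- by apply: pb_le Pdown _ => I _; rewrite size_map.
- refine (pb_le (pb_ext pb_entry_bound) _) => -[I t] [I_ok] /mapP[c] /[!mem_down] cC -> /=.
  by apply: (partial_entry_le (q1 := [::]) I_ok) => //; rewrite mem_head.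
- exact: comp_0.
apply: (comp_map (l := fun I : car G => down (ncol I))
  (f := fun I c => ((entry (full_table I) 0 c).1, c))) => //.
  by apply: comp_down; [exact: pb_ncol|rewrite /tabulated /prepared /input; comp_var].
apply: comp_pair; last by comp_var.
pose GD := ext_mem (fun I : car G => down (ncol I)).
apply: comp_fst; apply: (comp_entry (s := fun y : car GD => y.1)).
- exact: (pb_ext pb_ncol).
- exact: (pb_ext pb_full_table).
- exact: pb_const.
- by refine (pb_le (pb_ext pb_ncol) _) => -[I c] [_] /=; rewrite mem_down => /ltnW.
- by rewrite /tabulated; comp_var.
- exact: comp_0.
- by comp_var.
Qed.


Lemma comp_recolor : computes (G := G) tabulated
  (fun I => recolor (full_table I) (root I) (inst_order I)).
Proof.
apply: comp_let comp_root _.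
apply: (comp_rec (G := instances) (l := @inst_order K)
  (F := fun I s => recolor (full_table I) (root I) s)).
- exact: pb_order.
- by rewrite /tabulated /prepared; comp_var.
- exact: comp_Nil.
set GR := ext_rec _; pose r (y : car GR) := recolor (full_table y.1) (root y.1) y.2.2.
pose c (y : car GR) := look (root y.1) y.2.1.2 (child_colors (r y)).
have Pn := pb_ext pb_nvert : poly_bounded (G := GR) (fun y => nvert y.1).
have PC := pb_ext pb_ncol : poly_bounded (G := GR) (fun y => ncol y.1).
have mem_order (y : car GR) : ok y -> y.2.1 \in inst_order y.1.
  by case=> _ [s ->]; rewrite mem_cat mem_head orbT.
have y_lt (y : car GR) : ok y -> y.2.1.1 < nvert y.1 /\ y.2.1.2 < nvert y.1.
  by move/mem_order; case: (y.2.1) => w p; apply: order_lt.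
have par_key (y : car GR) : ok y -> y.2.1.2 \in 0 :: [seq e.1 | e <- inst_order y.1].
  move/mem_order; case: (y.2.1) => w p wp.
  exact: (grown_parent_mem (order_grown _) wp).
have cP (y : car GR) : ok y -> c y < ncol y.1.
  move=> y_ok; have pk := par_key y y_ok; case: y y_ok pk => I [e s] [[Iv [It _]]] [o1 /= oE] pk.
  have ps := order_parents oE.
  have := order_uniq I; rewrite oE -cat_rcons => uo.
  (* The partial coloring agrees with the complete one on the parent, and [color_lt] bounds the
     latter. *)
  rewrite /c /r /= -/(color_of _ _ _) -(color_of_cat _ _ uo ps) cat_rcons -oE.
  exact: (color_lt (nvert I) _ _ (order_uniq I) (@order_parents _ I) (few_children Iv It)).
have entryP (y : car GR) : ok y ->
    size (entry (full_table y.1) y.2.1.2 (c y)).2 <= size (inst_order y.1).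
  move=> y_ok; have cC := cP y y_ok; have := par_key y y_ok.
  rewrite -(mem_keys_bo (nvert y.1)) => /mapP[[p q] /= pq ->].
  have [[Iv [It _]] _] := y_ok.
  have [/and3P[/eqP aE _ _] _ _] := entry_argmin (tr y.1) (cost_table y.1)
    (order_uniq y.1) (@order_parents _ y.1) (few_children Iv It) pq cC.
  rewrite -(size_map (fun t => t.1)) aE size_map size_filter; exact: count_size.
have Pr : poly_bounded (G := GR) (fun y => size (r y)).
  refine (pb_le (pb_ext_rec pb_order) _) => y _.
  by rewrite -(size_map (fun x => x.1)) map_recolor.
rewrite /tabulated; apply: comp_Cons; last by comp_var.
apply: comp_pair; first by comp_var.
apply: comp_look.
- by refine (pb_le Pn _) => y /y_lt[/ltnW].
- by refine (pb_le (pb_ext pb_order) _) => y /entryP.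
- exact: comp_0.
- by comp_var.
apply: comp_snd; apply: (comp_entry (s := fun y : car GR => y.1)) => //.
- exact: (pb_ext pb_full_table).
- by refine (pb_le Pn _) => y /y_lt[_ /ltnW].
- by refine (pb_le PC _) => y /cP/ltnW.
- by comp_var.
- by comp_var.
apply: comp_look; try comp_var.
- by refine (pb_le Pn _) => y /y_lt[_ /ltnW].
- by refine (pb_le Pr _) => y _; rewrite size_map.
apply: (comp_map (f := fun _ x => (x.1.1, x.2)) (l := r)) => //; first by comp_var.
by apply: comp_pair; comp_var.
Qed.

Lemma comp_solver : computes (G := G) input
  (fun I => solver cc (nvert I) (ncol I) (nat_paths I) (cost_table I)).
Proof. exact: comp_trans comp_tabulated comp_recolor. Qed.

Lemma solver_in_poly_time : solvable_in_poly_time sz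
  (fun I => @path_cost K I cc) (tree_with_few_colorings sz b).
Proof.
(* Position 0 is kept for the entry point [e], so its auxiliary functions start at position 1. *)
have [p1 [e [tm [[c [d tmP]] H]]]] := comp_solver 1.
exists (e :: p1), (c%:P * ('X + 1) ^+ d)%R => I Iv Iq.
have I_ok : ok (c := G) I by [].
have seg : segment (e :: p1) 1 p1 by move=> i _.
have [t ev le] := H _ seg I I_ok.
have [s [chi [sE lc mc]]] := solver_correct Iv Iq.1 cc.
exists s, chi, t; split=> //.
- by rewrite /runs sE -enc_input.
- apply: leq_trans le (leq_trans (tmP I I_ok) _).
  by rewrite hornerM hornerC horner_exp hornerD hornerX hornerC natrME natrXE natrDE addn1.
Qed.

End Complexity.

(** * Bit sizes of rational numbers *)

Lemma ltn_bits m : m < 2 ^ bits m.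
Proof. exact: trunc_log_ltn. Qed.

Lemma bits_leq m k : 0 < k -> m < 2 ^ k -> bits m <= k.
Proof.
move=> k0; case: m => [|m] mk; first by rewrite /bits trunc_log0.
by rewrite /bits -(@ltn_exp2l 2) //; apply: leq_ltn_trans mk; apply: trunc_logP.
Qed.

Lemma leq_bits m n : m <= n -> bits m <= bits n.
Proof. by move=> mn; rewrite ltnS leq_trunc_log. Qed.

Definition height (x : rat) : nat := maxn `|numq x| `|denq x|.

(** Reduction to lowest terms divides numerator and denominator by a common nonzero factor. *)
Lemma height_div (a c : int) : c != 0%R -> height (a%:Q / c%:Q)%R <= maxn `|a| `|c|.
Proof.
rewrite /height; case: divqP => [|k x k0 _]; first by [].
by rewrite !abszM -maxnMr leq_pmull // absz_gt0.
Qed.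

(** The factor 2 comes from the two products in the numerator over the common denominator. *)
Lemma height_add x y : height (x + y)%R <= 2 * (height x * height y).
Proof.
have -> : (x + y = (numq x * denq y + numq y * denq x)%:Q / (denq x * denq y)%:Q)%R.
  rewrite -{1}[x]divq_num_den -{1}[y]divq_num_den rmorphD !rmorphM /=.
  by field; rewrite !intr_eq0 !denq_neq0.
apply: leq_trans (height_div _ _) _; first by rewrite mulf_neq0 ?denq_neq0.
have [nx dx ny dy] : [/\ `|numq x| <= height x, `|denq x| <= height x,
    `|numq y| <= height y & `|denq y| <= height y].
  by rewrite /height !leq_maxl !leq_maxr.
have num_le : `|(numq x * denq y + numq y * denq x)%R| <=
    `|numq x| * `|denq y| + `|numq y| * `|denq x|.
  by rewrite -!abszM; lia.
rewrite geq_max abszM mul2n -addnn; apply/andP; split.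
  apply: leq_trans num_le _; rewrite leq_add //; first exact: leq_mul.
  by rewrite mulnC leq_mul.
by apply: leq_trans (leq_mul dx dy) _; apply: leq_addr.
Qed.

(* Subadditive, unlike [rat_bits], and equivalent to it. *)
Definition rat_measure (x : rat) : nat := (bits (height x)).+1.

(** The factor 2 in [height_add] costs one bit, which the successor in [rat_measure] absorbs. *)
Lemma rat_measure_add x y : rat_measure (x + y)%R <= rat_measure x + rat_measure y.
Proof.
have : bits (height (x + y)%R) <= (bits (height x) + bits (height y)).+1.
  apply: bits_leq => //; apply: leq_ltn_trans (height_add x y) _.
  by rewrite expnS ltn_pmul2l // expnD ltn_mul ?ltn_bits.
by rewrite /rat_measure; lia.
Qed.

Lemma rat_bits_le x : rat_bits x <= 2 * rat_measure x.
Proof.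
rewrite /rat_bits /rat_measure.
have := @leq_bits `|numq x| (height x) (leq_maxl _ _).
have := @leq_bits `|denq x| (height x) (leq_maxr _ _).
lia.
Qed.

Lemma rat_measure_le x : rat_measure x <= rat_bits x.
Proof.
rewrite /rat_measure /rat_bits /height addn1 ltnS.
by case: (leqP `|numq x| `|denq x|); rewrite ?leq_addl ?leq_addr.
Qed.

Theorem theorem4 (b : {poly nat}) :
    (MINCC_poly_time rat_bits (tree_with_few_colorings rat_bits b) /\
     MINRC_poly_time rat_bits (tree_with_few_colorings rat_bits b)) /\
    (forall R : realType,
       MINCC_poly_time (@unit_size R) (tree_with_few_colorings (@unit_size R) b) /\
       MINRC_poly_time (@unit_size R) (tree_with_few_colorings (@unit_size R) b)).
Proof.
split.
  have H := solver_in_poly_time b _ rat_measure_add rat_bits_le rat_measure_le.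
  by split; [exact: (H true)|exact: (H false)].
(* Under unit cost the size serves as its own measure, and the three conditions on it hold by
   computation. *)
move=> R; have H cc := @solver_in_poly_time R (@unit_size R) (@unit_size R) b cc
  (fun _ _ => isT) (fun _ => isT) (fun _ => isT).
by split; [exact: (H true)|exact: (H false)].
Qed.
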